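(* Let $\ell,(\theta_k),p,\tau,(\lambda_k)$ satisfy the standing assumptions listed in the context, where $(\lambda_k)_{k\in\mathbb N_0}$ is a sequence of positive reals, and let $\vartheta^i_k,\alpha_i,\beta_i,S_i,\widehat S_i$ be as defined there. Assume that for each $i\in\{0,1,\dots,\ell\}$: $t\in S_i$ if and only if $\tau(t)\in\widehat S_i$. Assume further that there exist functions $\sigma_i:[\theta_0,\infty)\to[\vartheta^i_{-1},\infty)$ ($i\in\{0,1,\dots,\ell\}$) such that $\alpha_i(\sigma_i(t))=\tau(\alpha_i(t))$ for all $t\in[\theta_0,\infty)$, and $\sigma_i(\beta_i(t))=\beta_i(\tau(t))$ for all $t\in[\theta_0,\infty)$ in the domain of $\beta_i$. Consider the impulsive equation $$x'(t)+p(t)x(\tau(t))=0\ \ (t\in[\theta_0,\infty)\setminus\{\theta_k\}_{k\in\mathbb N_0}),\qquad x(\theta_k)=\lambda_kx(\theta_{k-\ell}^-)\ \ (k\in\mathbb N_0) \tag{I}$$ and, for $i\in\{0,1,\dots,\ell\}$, the nonimpulsive problem $$y_i'(t)+\Big[\prod_{j\in\mathbb N_0,\ \sigma_i(t)<\vartheta^i_j\le t}\frac1{\lambda_{j(\ell+1)+i}}\Big]p(\alpha_i(t))\,y_i(\sigma_i(t))=0\ \text{ for almost every }t\in[\theta_0,\infty),\qquad y_i(t)=\varphi(\alpha_i(t))\ \text{ for }t\in[\vartheta^i_{-1},\theta_0). \tag{N$_i$}$$ Then every solution of (I) is oscillatory on $S_i=\bigcup_{\nu\in\mathbb N_0}[\theta_{\nu(\ell+1)+i},\theta_{\nu(\ell+1)+i+1})$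 for some $i\in\{0,1,\dots,\ell\}$ if and only if every solution of (N$_i$) is oscillatory for the same $i$.
   Context: Conventions: $\mathbb N=\{1,2,\dots\}$, $\mathbb N_0=\mathbb N\cup\{0\}$; empty products are $1$, empty sums are $0$; $f(a^\pm)$ are one-sided limits; $AC([a,b],\mathbb R)$ is the set of absolutely continuous real functions on $[a,b]$. Standing assumptions: $p:[\theta_0,\infty)\to\mathbb R$ is Lebesgue measurable and locally essentially bounded; $\tau:[\theta_0,\infty)\to\mathbb R$ is Lebesgue measurable with $\tau(t)\le t$ for all $t\in[\theta_0,\infty)$ and $\lim_{t\to\infty}\tau(t)=\infty$; $\ell\in\mathbb N_0$ and $\theta_{-\ell}<\theta_{-\ell+1}<\dots<\theta_0<\theta_1<\cdots$ is an increasing divergent sequence of reals. Put $\rho_t:=\inf\{\tau(\xi):\xi\in[t,\infty)\}$ and $\theta_{-(\ell+1)}:=\rho_{\theta_0}$. Solution of (I) with initial function $\varphi\in AC([\rho_{\theta_0},\theta_0],\mathbb R)$: a function $x:[\rho_{\theta_0},\infty)\to\mathbb R$ such that for every $k\in\mathbb N_0$ it is absolutely continuous on $[\theta_k,\theta_{k+1})$ and both one-sided limits exist at $\theta_k$ with $x(\theta_k)=x(\theta_k^+)$; $x=\varphi$ on $[\rho_{\theta_0},\theta_0)$; $x'(t)+p(t)x(\tau(t))=0$ for every $t\in[\theta_0,\infty)\setminus\{\theta_k\}_{k\in\mathbb N_0}$; and $x(\theta_k)=\lambda_kx(\theta_{k-\ell}^-)$ for all $k\in\mathbb N_0$. A solution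 of (I) is a solution for some such $\varphi$. A solution of (N$_i$) is an absolutely continuous function on $[\vartheta^i_{-1},\infty)$ satisfying (N$_i$) for some such $\varphi$. Time changes. For $i\in\{0,\dots,\ell\}$: $\vartheta^i_{-1}:=\theta_0-[\theta_{-(\ell+1)+i+1}-\theta_{-(\ell+1)+i}]$, $\vartheta^i_0:=\theta_0$, $\vartheta^i_k:=\vartheta^i_{k-1}+\theta_{(k-1)(\ell+1)+i+1}-\theta_{(k-1)(\ell+1)+i}$ for $k\in\mathbb N$. Let $S_i:=\bigcup_{\nu\in\mathbb N_0}[\theta_{\nu(\ell+1)+i},\theta_{\nu(\ell+1)+i+1})$ and $\widehat S_i:=\bigcup_{\nu\in\mathbb N_0}[\theta_{(\nu-1)(\ell+1)+i},\theta_{(\nu-1)(\ell+1)+i+1})$. $\alpha_i:[\vartheta^i_{-1},\infty)\to\widehat S_i$ is $$\alpha_i(t)=t+[\theta_i-\theta_0]+\sum_{j\in\mathbb N,\ \theta_0<\vartheta^i_j\le t}[\theta_{j(\ell+1)+i}-\theta_{(j-1)(\ell+1)+i+1}]\ (t\in[\theta_0,\infty)),\qquad \alpha_i(t)=t-[\theta_0-\theta_{-(\ell+1)+i+1}]\ (t\in[\vartheta^i_{-1},\theta_0)).$$ $\beta_i:\widehat S_i\to[\vartheta^i_{-1},\infty)$ is $$\beta_i(t)=t-\Big\{[\theta_i-\theta_0]+\sum_{j\in\mathbb N,\ \theta_{j(\ell+1)+i}\le t}[\theta_{j(\ell+1)+i}-\theta_{(j-1)(\ell+1)+i+1}]\Big\}\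 (t\in S_i),\qquad \beta_i(t)=t+[\theta_0-\theta_{-(\ell+1)+i+1}]\ (t\in[\theta_{-(\ell+1)+i},\theta_{-(\ell+1)+i+1})).$$ It is noted that $\bigcup_{\nu\in\mathbb N_0}[\vartheta^i_{\nu-1},\vartheta^i_\nu)=[\vartheta^i_{-1},\infty)$, that $\alpha_i$ maps $[\vartheta^i_{k-1},\vartheta^i_k)$ onto $[\theta_{(k-1)(\ell+1)+i},\theta_{(k-1)(\ell+1)+i+1})$ for each $k\in\mathbb N_0$, and that $\alpha_i$ and $\beta_i$ are inverse to each other. Oscillation: a solution is nonoscillatory if it is eventually either positive or negative, and oscillatory otherwise; in other words, $x$ is oscillatory if there is an increasing divergent sequence $\{\xi_k\}_{k\in\mathbb N}\subset[\theta_0,\infty)$ with $x(\xi_k^+)x(\xi_k^-)\le0$ for all $k$. Oscillatory on $S_i$ means that the restriction of $x$ to $S_i$ is neither eventually positive nor eventually negative.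
   Formalization: The differential equation in (I) is required for almost every t, since with ''every t'' the claim fails for p altered on a null set; θ_{-(ℓ+1)} < θ_{-ℓ} and the noted identity ⋃[ϑ^i_{ν-1}, ϑ^i_ν) = [ϑ^i_{-1}, ∞) are assumed so that the objects are defined. *)

(* Defs.v *)
From mathcomp Require Export all_boot all_order all_algebra.
From mathcomp Require Export all_classical all_reals all_analysis measurable_realfun.
Set Implicit Arguments.
Unset Strict Implicit.
Unset Printing Implicit Defensive.
Export Order.TTheory GRing.Theory Num.Theory.
Export numFieldNormedType.Exports.
Global Open Scope classical_set_scope.
Global Open Scope ring_scope.

Section Analysis.
Variable R : realType.
Implicit Types (D : set R) (f : R -> R).

(* Lebesgue (not merely Borel) measurability: the source carries the completed
   sigma-algebra, the target the Borel one. *)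
Definition lebesgue_measurable_fun D f : Prop :=
  @measurable_fun _ _
    (g_sigma_algebraType (completed_algebra_gen (@lebesgue_measure R)))
    (measurableTypeR R) D f.

Definition loc_ess_bounded D f : Prop :=
  forall K : set R, compact K -> K `<=` D ->
    exists M : R, {ae @lebesgue_measure R, forall t, K t -> `|f t| <= M}.

(* D is meant to be an interval, so that [a i, b i] is contained in D as soon
   as its endpoints are. *)
Definition abs_cont D f : Prop :=
  forall e : R, 0 < e -> exists2 d : R, 0 < d &
    forall (n : nat) (a b : 'I_n -> R),
      (forall i, [/\ D (a i), D (b i) & a i <= b i]) ->
      trivIset setT (fun i => `]a i, b i[%classic) ->
      \sum_(i < n) (b i - a i) < d ->
      \sum_(i < n) `|f (b i) - f (a i)| < e.

(* On an unbounded interval absolute continuity is required on the compact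
   subintervals only. *)
Definition abs_cont_ray (a : R) f : Prop :=
  forall b : R, a <= b -> abs_cont `[a, b] f.

Definition eventually_pos D f : Prop :=
  exists T : R, forall t, D t -> T <= t -> 0 < f t.

Definition eventually_neg D f : Prop :=
  exists T : R, forall t, D t -> T <= t -> f t < 0.

Definition oscillatory_on D f : Prop :=
  ~ eventually_pos D f /\ ~ eventually_neg D f.

(* [inf] is real-valued: the infimum is meaningful when tau is bounded below on
   [t, +oo). *)
Definition rho (tau : R -> R) (t : R) : R := inf (tau @` `[t, +oo[).

End Analysis.

(* theta_k is defined for the integers k >= - (ell + 1); the values of
   [theta] at smaller integers are never used. *)
Section TimeChange.
Variables (R : realType) (ell : nat) (theta : int -> R).

Definition idx (i : nat) (m : int) : int := m * ell.+1%:Z + i%:Z.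

Definition block (i : nat) (m : int) : set R :=
  `[theta (idx i m), theta (idx i m + 1)[.

Definition S_ (i : nat) : set R := \bigcup_(nu in [set: nat]) block i nu%:Z.

Definition hatS (i : nat) : set R :=
  \bigcup_(nu in [set: nat]) block i (nu%:Z - 1).

Fixpoint vtheta_nat (i : nat) (k : nat) : R :=
  match k with
  | 0%N => theta 0
  | k'.+1 => vtheta_nat i k' + theta (idx i k'%:Z + 1) - theta (idx i k'%:Z)
  end.

(* Meaningful for k >= -1. *)
Definition vtheta (i : nat) (k : int) : R :=
  match k with
  | Posz n => vtheta_nat i n
  | Negz _ => theta 0 - (theta (idx i (-1) + 1) - theta (idx i (-1)))
  end.

(* The finitely supported sums [\sum_(j \in A)] are the intended ones only when
   finitely many of their terms are nonzero; for t >= theta_0 this holds in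
   [alpha] and in the product of (N_i) when vtheta_k^i tends to infinity. *)
Definition alpha (i : nat) (t : R) : R :=
  if theta 0 <= t then
    t + (theta i%:Z - theta 0) +
    \sum_(j \in [set j : nat |
                  (0 < j)%N /\ theta 0 < vtheta i j%:Z <= t])
      (theta (idx i j%:Z) - theta (idx i (j%:Z - 1) + 1))
  else t - (theta 0 - theta (idx i (-1) + 1)).

Definition beta (i : nat) (t : R) : R :=
  if t \in S_ i then
    t - ((theta i%:Z - theta 0) +
         \sum_(j \in [set j : nat | (0 < j)%N /\ theta (idx i j%:Z) <= t])
           (theta (idx i j%:Z) - theta (idx i (j%:Z - 1) + 1)))
  else t + (theta 0 - theta (idx i (-1) + 1)).

End TimeChange.

Section Equations.
Variables (R : realType) (ell : nat) (theta : int -> R) (p tau : R -> R).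
Variable lambda : nat -> R.

Definition initial_function (phi : R -> R) : Prop :=
  abs_cont `[rho tau (theta 0), theta 0] phi.

(* Solutions are total functions of which only the restriction to
   [rho_{theta_0}, +oo) matters.  They are Caratheodory solutions: p is only
   measurable, so the differential equation is required almost everywhere.
   Required at every point, it would depend on the values of p on null sets,
   to which the almost everywhere equation of solution_N_init is blind. *)
Definition solution_I_init (phi x : R -> R) : Prop :=
  [/\ forall k : nat,
        [/\ abs_cont `[theta k%:Z, theta (k%:Z + 1)[ x,
            cvg (x @ (theta k%:Z)^'-) &
            x @ (theta k%:Z)^'+ --> x (theta k%:Z)],
      forall t, rho tau (theta 0) <= t < theta 0 -> x t = phi t,
      {ae @lebesgue_measure R, forall t, theta 0 <= t ->
        (forall k : nat, t <> theta k%:Z) ->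
        derivable x t 1 /\ derive1 x t + p t * x (tau t) = 0} &
      forall k : nat, x (theta k%:Z) =
        lambda k * lim (x @ (theta (k%:Z - ell%:Z))^'-)].

Definition solution_I (x : R -> R) : Prop :=
  exists2 phi, initial_function phi & solution_I_init phi x.

Definition coef_N (i : nat) (sigma : R -> R) (t : R) : R :=
  (\big[*%R/1]_(j \in [set j : nat | sigma t < vtheta ell theta i j%:Z <= t])
     (lambda (j * ell.+1 + i))^-1)
  * p (alpha ell theta i t).

Definition solution_N_init (i : nat) (sigma phi y : R -> R) : Prop :=
  [/\ abs_cont_ray (vtheta ell theta i (-1)) y,
      {ae @lebesgue_measure R, forall t, theta 0 <= t ->
        derivable y t 1 /\ derive1 y t + coef_N i sigma t * y (sigma t) = 0} &
      forall t, vtheta ell theta i (-1) <= t < theta 0 ->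
        y t = phi (alpha ell theta i t)].

Definition solution_N (i : nat) (sigma y : R -> R) : Prop :=
  exists2 phi, initial_function phi & solution_N_init i sigma phi y.

End Equations.

(* Main.v *)
(* On the blocks of hatS_i the map alpha_i is a translation.  With
   Lam_n = prod_{j < n} lambda_(j (ell + 1) + i), the relation
   x (alpha_i s) = Lam_n y s, for s in the n-th block, exchanges the restrictions
   to hatS_i of the solutions of (I) and the solutions of (N_i): the jump
   conditions say that y is continuous across blocks, and the coefficient
   product of (N_i) is Lam_m / Lam_n when sigma_i s lies in the m-th block.
   Since Lam_n > 0, it also preserves eventual signs.

   Going back from y to x needs some solution of (I) on the other sets S_j,
   which do not interact with S_i.  It is obtained by the method of steps: on
   each [theta_k, theta_(k + 1)) the equation is a linear Volterra equation with
   delay, solved by Picard iteration. *)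

Require Import Defs.
From mathcomp Require Import ring lra zify.
Set Implicit Arguments.
Unset Strict Implicit.
Unset Printing Implicit Defensive.

(** * Null sets and Borel versions *)

(** A solution of (N_i) says nothing about x off S_i, whereas a solution of (I) lives on the whole
    half-line; so a solution of (I) with the same initial function is built first and then
    overwritten on S_i. This is harmless off S_i: by the hypothesis relating S_i and hatS_i, a time
    outside S_i has its delayed time outside S_i too, and a jump at theta_k reads the left limit at
    the right end of the interval with index k - (ell + 1), hence in the same residue class.
    Existence has to cope with p and tau that are only Lebesgue measurable. They are replaced by
    Borel functions that agree with them off a null set, so that Picard iterates composed with the
    delay stay Borel; an equation that holds almost everywhere tolerates this. Such an equation also
    moves between the two time scales, because each block is shifted by a constant and translations
    preserve null sets. *)

Section NullSets.
Variable R : realType.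
Notation mu := (@lebesgue_measure R).

Lemma ae_imply (P Q : R -> Prop) : (forall t, P t -> Q t) ->
  {ae mu, forall t, P t} -> {ae mu, forall t, Q t}.
Proof. by move=> PQ; apply: filterS; first exact: (ae_filter_ringOfSetsType mu). Qed.

Lemma ae_imply2 (P Q S : R -> Prop) : (forall t, P t -> Q t -> S t) ->
  {ae mu, forall t, P t} -> {ae mu, forall t, Q t} -> {ae mu, forall t, S t}.
Proof. by move=> PQ; apply: filterS2; first exact: (ae_filter_ringOfSetsType mu). Qed.

(** The pushforward of Lebesgue measure under a translation has the same values on half-open
    intervals, hence is Lebesgue measure. *)
Lemma ae_addr (P : R -> Prop) (c : R) :
  {ae mu, forall t, P t} -> {ae mu, forall t, P (t + c)}.
Proof.
move=> [N [mN N0 PN]].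
pose f := (fun x : R => x + c) : measurableTypeR R -> measurableTypeR R.
have mf : measurable_fun setT f by apply: measurable_funD.
pose g := mfun_Sub (mem_set mf).
have gE X : ocitv X -> mu X = pushforward mu g X.
  move=> [[x y] _ <-].
  transitivity (mu `]x - c, y - c]%classic).
    rewrite !lebesgue_measure_itv/= !lte_fin ltrD2r; case: ifPn => // _.
    by rewrite -!EFinB; congr (_%:E); ring.
  congr (mu _); apply/seteqP; split => z /=;
  by rewrite !in_itv/= /f ltrBlDr lerBrDr.
have fN : pushforward mu f N = 0 by rewrite -N0 (lebesgue_measure_unique gE).
exists (f @^-1` N); split => //.
- by rewrite -[X in measurable X]setTI; have := mf; apply.
- by move=> t /= Pt; exact: PN.
Qed.

Lemma ae_neq (u : nat -> R) : {ae mu, forall t, forall k, t <> u k}.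
Proof.
apply: ae_foralln => k; exists [set u k]; split => //.
  exact: lebesgue_measure_set1.
by move=> t /= /contrapT.
Qed.

(** The preimage of each ray with rational end is Borel up to a null set. The union of these
    countably many null sets serves all rays at once, because a ray with real end is a union of
    rational ones. *)
Lemma lebesgue_borel_measurable (D : set R) (f : R -> R) : measurable D ->
  lebesgue_measurable_fun D f ->
  exists N, [/\ measurable N, mu N = 0 & measurable_fun (D `\` N) f].
Proof.
move=> mD mf.
have mfq (q : rat) : exists A N, [/\ measurable A, measurable N, mu N = 0,
    A `<=` D `&` f @^-1` `]ratr q, +oo[%classic &
    D `&` f @^-1` `]ratr q, +oo[%classic `<=` A `|` N].
  have : (completed_algebra_gen mu).-sigma.-measurable
      (D `&` f @^-1` `]ratr q, +oo[%classic).
    apply: mf => //; apply: sub_sigma_algebra; exists D => //.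
    by exists set0; [exact: negligible_set0|rewrite setU0].
  rewrite g_sigma_completed_algebra_genE => -[A mA [N [N' [mN' N'0 NN']] AN]].
  exists A, N'; split => //; rewrite -AN; first exact: subsetUl.
  exact: setUS.
have [A /choice[N NQ]] := choice mfq.
have mN : measurable (\bigcup_q N q).
  by apply: bigcupT_measurable_rat => q; have [] := NQ q.
exists (\bigcup_q N q); split => //.
  apply/negligibleP => //.
  pose N' n := if unpickle n is Some q then N q else set0.
  have sub : \bigcup_q N q `<=` \bigcup_n N' n.
    move=> x [q _ Nx]; exists (pickle q); first exact: I.
    rewrite /N' pickleK; exact: Nx.
  apply: (@negligibleS _ _ _ mu _ _ sub).
  apply: negligible_bigcup => n; rewrite /N'; case: unpickle => [q|].
    by apply/negligibleP; have [] := NQ q.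
  exact: negligible_set0.
apply: (measurability _ (RGenOInfty.measurableE R)).
move=> _ [_ [x ->] <-].
rewrite (_ : _ `&` _ = \bigcup_q (if x < ratr q then A q `\` \bigcup_q N q
   else set0)); last first.
  apply/seteqP; split => [t [[Dt Nt]] /=|t [q _]].
    rewrite in_itv/= andbT => /rat_in_itvoo[q] /andP/=[];
      rewrite !bnd_simp => xq qt.
    exists q => //; rewrite xq; split => //.
    have [_ _ _ _] := NQ q => /(_ t) [|//|Nqt].
      by split => //=; rewrite in_itv/= qt.
    by exfalso; apply: Nt; exists q.
  case: ifPn => // xq [Aqt Nt].
  have [_ _ _ + _] := NQ q => /(_ _ Aqt)[Dt].
  rewrite /= !in_itv/= !andbT => qt; split; first by split.
  exact: lt_trans qt.
apply: bigcupT_measurable_rat => q; case: ifPn => // _.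
by apply: measurableD => //; have [] := NQ q.
Qed.

End NullSets.

(** * Lipschitz primitives and the integral of the exponential weight *)

Section Primitives.
Variable R : realType.
Notation mu := (@lebesgue_measure R).

Lemma bounded_integrable (g : R -> R) (i : interval R) (x y G : R) :
  measurable_fun setT g -> (forall t, t <= y -> `|g t| <= G) ->
  [set` i] `<=` `[x, y] -> mu.-integrable [set` i] (EFin \o g).
Proof.
move=> mg gG ixy.
suff : mu.-integrable `[x, y] (EFin \o g) by apply: integrableS.
apply: measurable_bounded_integrable => //.
- by rewrite /= lebesgue_measure_itv/=; case: ifPn => // _; rewrite -EFinB ltry.
- exact: measurable_funTS.
- exists G; split; first exact: num_real.
  move=> z Gz t /=; rewrite in_itv/= => /andP[_ ty].
  by rewrite (le_trans (gG _ ty))// ltW.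
Qed.

Lemma normr_Rintegral_le (g k : R -> R) (x y : R) :
  mu.-integrable `[x, y] (EFin \o g) -> mu.-integrable `[x, y] (EFin \o k) ->
  (forall t, x <= t <= y -> `|g t| <= k t) ->
  `|\int[mu]_(t in `[x, y]) g t| <= \int[mu]_(t in `[x, y]) k t.
Proof.
move=> ig ik gk; apply: le_trans (le_normr_Rintegral _ ig) _ => //.
apply: le_Rintegral => //; exact: integrable_norm.
Qed.

(** The integral over [[a, x]] vanishes for x < a, so the primitive is constant there and the
    estimate holds on the whole half-line up to [T]. *)
Lemma primitive_lipschitz (a T G : R) (g : R -> R) :
  measurable_fun setT g -> (forall t, t <= T -> `|g t| <= G) ->
  forall x y, x <= T -> y <= T ->
  `|\int[mu]_(t in `[a, x]) g t - \int[mu]_(t in `[a, y]) g t| <= G * `|x - y|.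
Proof.
move=> mg gG x y.
have G0 : 0 <= G by rewrite (le_trans _ (gG T _)).
have ig z t : t <= T -> mu.-integrable `[z, t] (EFin \o g).
  move=> tT; apply: (@bounded_integrable _ _ z t G) => // u ut.
  by rewrite gG// (le_trans ut).
have bnd z t : z <= t <= T -> `|\int[mu]_(t in `[z, t]) g t| <= G * (t - z).
  move=> /andP[zt tT].
  have := @normr_Rintegral_le g (cst G) z t (ig _ _ tT).
  rewrite Rintegral_cst//= lebesgue_measure_itv/= lte_fin.
  have -> : fine (if z < t then (t%:E - z%:E)%E else 0%E) = t - z.
    by case: ltgtP zt => // ->; rewrite subrr.
  apply; last by move=> u /andP[_ ut]; rewrite gG// (le_trans ut).
  apply: (@bounded_integrable _ _ z t G) => // u _.
  by rewrite ger0_norm.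
wlog yx : x y / y <= x.
  move=> H xT yT; have [|/ltW] := leP y x => xy; first exact: H.
  by rewrite distrC [`|x - y|]distrC; exact: H.
move=> xT yT; rewrite (ger0_norm (x := x - y)) ?subr_ge0//.
have [ya|ay] := ltP y a.
  rewrite [X in _ - X](_ : _ = 0) ?subr0; last first.
    by rewrite set_itv_ge ?Rintegral_set0// bnd_simp -ltNge.
  have [xa|ax] := ltP x a.
    rewrite set_itv_ge ?Rintegral_set0 ?normr0; last by rewrite bnd_simp -ltNge.
    by rewrite mulr_ge0// subr_ge0.
  rewrite (le_trans (bnd _ _ _)) ?ax//.
  by rewrite ler_wpM2l// lerD2l lerN2 ltW.
rewrite Rintegral_itvB//; first by rewrite Rintegral_itv_obnd_cbnd ?bnd ?yx//
  (integrableS _ _ _ (ig y x xT))//; exact: subset_itv_oc_cc.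
exact: ig.
Qed.

(** This integrates the weight of the Picard estimates; the division by [L] is the source of their
    contraction factor. *)
Lemma Rintegral_expR (L a t : R) : 0 < L -> a <= t ->
  \int[mu]_(r in `[a, t]) expR (L * (r - a)) = (expR (L * (t - a)) - 1) / L.
Proof.
move=> L0; rewrite le_eqVlt => /predU1P[<-|at_].
  by rewrite set_itv1 Rintegral_set1 subrr mulr0 expR0 subrr mul0r.
pose F r := expR (L * (r - a)) / L.
have dF (r : R) : is_derive r 1 F (expR (L * (r - a))).
  rewrite /F; apply: is_derive_eq.
  rewrite /GRing.scale/= ; field; exact: lt0r_neq0.
have cF (r : R) : {for r, continuous F}.
  by apply/differentiable_continuous/derivable1_diffP; have [] := dF r.
rewrite /Rintegral (@continuous_FTC2 _ _ F)//.
- by rewrite /= /F subrr mulr0 expR0 mulrBl.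
- apply: continuous_subspaceT => r.
  apply: (@continuous_comp _ _ _ (fun r => L * (r - a)) expR); last first.
    exact: continuous_expR.
  by apply: cvgM; [exact: cvg_cst|apply: cvgB; [exact: cvg_id|exact: cvg_cst]].
- split; first by move=> r _; have [] := dF r.
    by apply: cvg_at_right_filter; exact: cF.
  by apply: cvg_at_left_filter; exact: cF.
- by move=> r _; rewrite derive1E; have [_ ->] := dF r.
Qed.

End Primitives.

(** * Linear Volterra equations with delay *)

Section GeometricCauchy.
Variable R : realType.
Implicit Types (v : nat -> R) (D : R).

Lemma geometric_cauchy_cvg v D :
  (forall n j, `|v (n + j)%N - v n| <= D * 2^-1 ^+ n) -> cvgn v.
Proof.
move=> vD; apply/cauchy_cvgP; apply/cauchy_exP => e e0 /=.
have : D * 2^-1 ^+ n @[n --> \oo] --> (0 : R).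
  rewrite -[0](mulr0 D); apply: cvgM; first exact: cvg_cst.
  by apply: cvg_expr; rewrite ger0_norm; lra.
move=> /cvgr0_norm_lt /(_ _ e0) [N _ HN].
exists (v N); exists N => // n /= Nn.
rewrite /ball/= distrC -(subnKC Nn); apply: le_lt_trans (vD _ _) _.
by apply: le_lt_trans (HN N (leqnn N)); exact: ler_norm.
Qed.

Lemma geometric_cauchy_lim v D n :
  (forall n j, `|v (n + j)%N - v n| <= D * 2^-1 ^+ n) ->
  `|limn v - v n| <= D * 2^-1 ^+ n.
Proof.
move=> vD; have cv := geometric_cauchy_cvg vD.
have : `|v (j + n)%N - v n| @[j --> \oo] --> `|limn v - v n|.
  apply: cvg_norm; apply: cvgB; last exact: cvg_cst.
  by rewrite (cvg_shiftn n).
move=> /cvg_lim <- //; apply: limr_le.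
  apply: is_cvg_norm; apply: is_cvgB; last exact: is_cvg_cst.
  by apply/cvg_ex; exists (limn v); rewrite (cvg_shiftn n).
by near=> j; rewrite addnC; exact: vD.
Unshelve. all: by end_near. Qed.

Lemma geometric_eq0 (z D : R) : (forall n, `|z| <= D * 2^-1 ^+ n) -> z = 0.
Proof.
move=> zD; have [->//|z0] := eqVneq z 0.
have : D * 2^-1 ^+ n @[n --> \oo] --> (0 : R).
  rewrite -[0](mulr0 D); apply: cvgM; first exact: cvg_cst.
  by apply: cvg_expr; rewrite ger0_norm; lra.
move=> /cvgr0_norm_lt /(_ `|z|); rewrite normr_gt0 => /(_ z0) [N _ HN].
have := HN N (leqnn N); rewrite /= ltNge => /negP; case.
by rewrite (le_trans (zD N))// ler_norm.
Qed.

End GeometricCauchy.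

Section Volterra.
Variable R : realType.
Notation mu := (@lebesgue_measure R).

(** The bound is on left half-lines rather than compact sets: a delayed argument never exceeds the
    current time but may lie arbitrarily far to its left. *)
Definition locally_bounded_measurable (u : R -> R) : Prop :=
  measurable_fun setT u /\ forall T, exists B, forall t, t <= T -> `|u t| <= B.

Variables (a c M K : R) (q s h : R -> R).
Hypotheses (M0 : 0 < M) (mq : measurable_fun setT q).
Hypotheses (ms : measurable_fun setT s) (mh : measurable_fun setT h).
Hypotheses (qM : forall t, `|q t| <= M) (sle : forall t, s t <= t).
Hypothesis hK : forall t, `|h t| <= K.

Let G u r := q r * (if s r < a then h (s r) else u (s r)).
(** The Picard operator; its integral is empty before [a], so every iterate equals [c] there. *)
Let P u t := c + \int[mu]_(r in `[a, t]) G u r.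

Let lbm_G u : locally_bounded_measurable u -> locally_bounded_measurable (G u).
Proof.
move=> [mu_ ub]; split.
  apply: measurable_funM => //; apply: measurable_fun_ifT.
  - by apply: measurable_fun_ltr => //; exact: measurable_cst.
  - exact: measurableT_comp.
  - exact: measurableT_comp.
move=> T; have [B uB] := ub T; exists (M * Num.max K B) => t tT.
rewrite normrM; apply: ler_pM => //; case: ifP => _.
  by rewrite le_max hK.
by rewrite le_max uB ?orbT// (le_trans (sle _)).
Qed.

Let P_lt u t : t < a -> P u t = c.
Proof.
by move=> ta; rewrite /P set_itv_ge ?Rintegral_set0 ?addr0// bnd_simp -ltNge.
Qed.

Let P_a u : P u a = c.
Proof. by rewrite /P set_itv1 Rintegral_set1 addr0. Qed.

Let P_lip u T : locally_bounded_measurable u -> exists2 B, 0 <= B &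
  forall x y, x <= T -> y <= T -> `|P u x - P u y| <= B * `|x - y|.
Proof.
move=> /lbm_G[mG GB]; have [B HB] := GB T; exists B.
  by rewrite (le_trans _ (HB T _)).
move=> x y xT yT.
rewrite (_ : P u x - P u y = \int[mu]_(r in `[a, x]) G u r -
  \int[mu]_(r in `[a, y]) G u r); last by rewrite /P; ring.
have := primitive_lipschitz a mG HB xT yT; exact.
Qed.

Let lbm_P u : locally_bounded_measurable u -> locally_bounded_measurable (P u).
Proof.
move=> lu; split.
  apply: continuous_measurable_fun => x.
  have [B B0 HB] := P_lip (x + 1) lu.
  apply/cvgrPdist_le => e e0; near=> y.
  rewrite (le_trans (HB _ _ _ _))//; first by rewrite lerDl.
    have : `|x - y| <= 1 by near: y; apply: cvgr_dist_le.
    by rewrite ler_distlC => /andP[].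
  have : `|x - y| <= e / (B + 1).
    by near: y; apply: cvgr_dist_le => //; rewrite divr_gt0// ltr_wpDl.
  rewrite ler_pdivlMr ?ltr_wpDl// => h1; apply: le_trans h1.
  by rewrite mulrC ler_wpM2l// lerDl.
move=> T; have [B B0 HB] := P_lip (Num.max a T) lu.
exists (`|c| + B * `|T - a|) => t tT.
have [ta|at_] := ltP t a; first by rewrite P_lt// lerDl mulr_ge0.
have := HB t a; rewrite !le_max tT lexx orbT => /(_ erefl erefl).
rewrite P_a => h1; rewrite -[P u t](subrK c) addrC.
apply: le_trans (ler_normD _ _) _; rewrite lerD2l (le_trans h1)// ler_wpM2l//.
by rewrite !ger0_norm ?subr_ge0// ?lerD2r// (le_trans at_).
Unshelve. all: by end_near. Qed.

Let P_sub u v (k : R -> R) t : locally_bounded_measurable u -> locally_bounded_measurable v ->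
  a <= t -> mu.-integrable `[a, t] (EFin \o k) ->
  (forall r, a <= r <= t -> `|G u r - G v r| <= k r) ->
  `|P u t - P v t| <= \int[mu]_(r in `[a, t]) k r.
Proof.
move=> /lbm_G[mu_ uB] /lbm_G[mv vB] at_ ik Gk.
have iG (w : R -> R) : measurable_fun setT w ->
    (forall T, exists B, forall t, t <= T -> `|w t| <= B) ->
    mu.-integrable `[a, t] (EFin \o w).
  move=> mw wB; have [B wtB] := wB t.
  exact: (@bounded_integrable _ _ _ a t B).
rewrite (_ : P u t - P v t = \int[mu]_(r in `[a, t]) (G u r - G v r)).
  apply: normr_Rintegral_le => //.
  apply: iG; first exact: measurable_funB.
  move=> T; have [B1 HB1] := uB T; have [B2 HB2] := vB T; exists (B1 + B2).
  by move=> r rT; rewrite (le_trans (ler_normB _ _))// lerD ?HB1 ?HB2.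
rewrite RintegralB//; [by rewrite /P; ring|exact: iG|exact: iG].
Qed.

Let L := 2 * M.
Let L0 : 0 < L. Proof. by rewrite /L mulr_gt0. Qed.
(** A common bound for the past [h] and for the zeroth iterate, the constant [c]. *)
Let C := `|c| + K.
Let K0 : 0 <= K. Proof. exact: le_trans (hK 0). Qed.
Let C0 : 0 <= C. Proof. by rewrite addr_ge0. Qed.
Let U n : R -> R := iter n P (cst c).

Let lbm_U n : locally_bounded_measurable (U n).
Proof.
elim: n => [|n IH]; last exact: lbm_P.
by split; [exact: measurable_cst|move=> T; exists `|c|].
Qed.

Let U_lt n t : t < a -> U n t = c.
Proof. by case: n => [//|n] ta; rewrite /U iterS P_lt. Qed.

(* The weight expR (2 M (t - a)) makes each integration gain a factor 1/2. *)
Let U_succ n t : a <= t ->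
  `|U n.+1 t - U n t| <= C * 2^-1 ^+ n * expR (L * (t - a)).
Proof.
elim: n t => [|n IH] t at_.
  rewrite expr0 mulr1 /U /= .
  have [mG _] := lbm_G (lbm_U 0).
  have := @primitive_lipschitz R a t (M * C) _ mG _ t a (lexx _) at_.
  rewrite set_itv1 Rintegral_set1 subr0 (ger0_norm (x := t - a)) ?subr_ge0//.
  move=> H; rewrite /P addrAC subrr add0r; apply: le_trans (H _) _.
    move=> r _; rewrite normrM; apply: ler_pM => //; rewrite /C.
    case: ifP => _; first by rewrite (le_trans (hK _))// lerDr.
    by rewrite /U/= lerDl.
  rewrite [leLHS](_ : _ = C * (M * (t - a))); last by ring.
  rewrite ler_wpM2l//.
  (* The inequality 1 + z <= exp z with z = 2 M (t - a) absorbs M (t - a). *)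
  have := expR_ge1Dx (L * (t - a)); rewrite /L.
  have : 0 <= M * (t - a) by rewrite mulr_ge0 ?subr_ge0// ltW.
  nra.
rewrite /U !(iterS _ P) -/(U _) -/(U _).
have ic (k : R) : mu.-integrable `[a, t] (EFin \o (fun r => k * expR (L * (r - a)))).
  apply: (@bounded_integrable _ _ _ a t (`|k| * expR (L * (t - a)))) => //.
    apply: measurable_funM; first exact: measurable_cst.
    apply: measurableT_comp => //; apply: measurable_funM => //.
    exact: measurable_funB.
  move=> r rt; rewrite normrM ler_wpM2l// ger0_norm ?expR_ge0//.
  by rewrite ler_expR ler_wpM2l ?(ltW L0)// lerD2r.
apply: le_trans (P_sub _ _ at_ (ic (M * (C * 2^-1 ^+ n))) _) _.
- exact: (lbm_U n.+1).
- exact: lbm_U.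
- move=> r /andP[ar rt]; rewrite /G -mulrBr normrM -mulrA; apply: ler_pM => //.
  have D0 x : 0 <= C * 2^-1 ^+ n * expR x.
    by rewrite mulr_ge0 ?expR_ge0// mulr_ge0// exprn_ge0.
  case: ltP => [_|asr]; first by rewrite subrr normr0.
  (* The weight is increasing, so the induction hypothesis at the delayed time [s r <= r] is no
     worse than at [r]. *)
  apply: le_trans (IH _ asr) _; rewrite ler_wpM2l ?ler_expR//.
    by rewrite mulr_ge0// exprn_ge0.
  by rewrite ler_wpM2l ?(ltW L0)// lerD2r.
rewrite RintegralZl//; last first.
  by have := ic 1; congr (integrable _ _ _); apply/funext => r /=; rewrite mul1r.
rewrite Rintegral_expR// exprS; set e := expR _; set D := C * 2^-1 ^+ n.
have D0 : 0 <= D by rewrite mulr_ge0// exprn_ge0.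
rewrite [leLHS](_ : _ = D * (e - 1) / 2); last first.
  by rewrite /L; field; exact: lt0r_neq0.
rewrite [leRHS](_ : _ = D * e / 2); last by rewrite /D; field.
by rewrite ler_wpM2r// ler_wpM2l// gerBl.
Qed.

(** The factor 2 sums the geometric tail of the bounds in [U_succ]; before [a], where all iterates
    agree, [E] is frozen. *)
Let E t := 2 * C * expR (L * (Num.max t a - a)).

Let E0 t : 0 <= E t.
Proof. by rewrite /E mulr_ge0 ?expR_ge0// mulr_ge0. Qed.

Let E_le x y : x <= y -> E x <= E y.
Proof.
move=> xy; rewrite /E ler_wpM2l ?mulr_ge0// ler_expR ler_wpM2l ?(ltW L0)//.
by rewrite lerD2r ge_max !le_max xy lexx orbT.
Qed.

Let U_cauchy t n j : `|U (n + j)%N t - U n t| <= E t * 2^-1 ^+ n.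
Proof.
have [ta|at_] := ltP t a.
  by rewrite !U_lt// subrr normr0 mulr_ge0// exprn_ge0.
(* With the subtracted term kept, the induction on [j] closes exactly: the bound of [U_succ] is the
   increment of the right-hand side. *)
suff : `|U (n + j)%N t - U n t| <= E t * (2^-1 ^+ n - 2^-1 ^+ (n + j)).
  move=> /le_trans; apply; rewrite ler_wpM2l// gerBl exprn_ge0//.
elim: j => [|j IH]; first by rewrite addn0 !subrr normr0 mulr0.
rewrite addnS -(subrK (U (n + j)%N t) (U (n + j).+1 t)) -addrA.
apply: le_trans (ler_normD _ _) _.
apply: le_trans (lerD (U_succ _ at_) IH) _.
rewrite /E (max_idPl at_) exprS.
by rewrite le_eqVlt; apply/orP; left; apply/eqP; field.
Qed.

Let u t := limn (fun n => U n t).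

Let u_U t n : `|u t - U n t| <= E t * 2^-1 ^+ n.
Proof. exact: geometric_cauchy_lim (U_cauchy t). Qed.

Let lbm_u : locally_bounded_measurable u.
Proof.
split.
  apply: (@measurable_fun_cvg _ _ _ _ U) => [n|t _].
    by have [] := lbm_U n.
  exact: geometric_cauchy_cvg (U_cauchy t).
move=> T; exists (E T + `|c|) => t tT.
rewrite -(subrK c (u t)); apply: le_trans (ler_normD _ _) _; rewrite lerD2r.
by have := u_U t 0; rewrite expr0 mulr1 => /le_trans; apply; exact: E_le.
Qed.

(** Both [u] and [P u] are within a multiple of 2^-n of the iterate [U n.+1], so they coincide. The
    integrand is returned with its bounds because the solution is later differentiated as its
    primitive. *)
Lemma volterra : exists u,
  let g r := q r * (if s r < a then h (s r) else u (s r)) in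
  [/\ locally_bounded_measurable u, locally_bounded_measurable g &
      forall t, u t = c + \int[mu]_(r in `[a, t]) g r].
Proof.
exists u; split => //; first exact: lbm_G.
move=> t; rewrite -/(P u t).
have [ta|at_] := ltP t a.
  rewrite P_lt// /u; under eq_fun do rewrite U_lt//.
  by apply: cvg_lim => //; exact: cvg_cst.
apply/eqP; rewrite -subr_eq0; apply/eqP.
(* [E t] bounds the distance from [u] to [U n.+1]; the other term comes from integrating the
   difference of the integrands over [[a, t]]. *)
apply: (@geometric_eq0 _ _ (E t + M * E t * (t - a))) => n.
rewrite -(subrK (U n.+1 t) (u t)) -addrA; apply: le_trans (ler_normD _ _) _.
rewrite mulrDl; apply: lerD.
  apply: le_trans (u_U _ _) _; rewrite ler_wpM2l// exprS.
  by rewrite ler_piMl ?exprn_ge0//; lra.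
have icst (k : R) : mu.-integrable `[a, t] (EFin \o cst k).
  by apply: (@bounded_integrable _ _ _ a t `|k|).
apply: le_trans (P_sub _ _ at_ (icst (M * (E t * 2^-1 ^+ n))) _) _ => //.
  move=> r /andP[ar rt]; rewrite /G -mulrBr normrM; apply: ler_pM => //.
  case: ltP => [_|asr]; first by rewrite subrr normr0 mulr_ge0// exprn_ge0.
  rewrite distrC; apply: le_trans (u_U _ _) _; rewrite ler_wpM2r ?exprn_ge0//.
  by apply: E_le; rewrite (le_trans (sle _)).
rewrite Rintegral_cst//= lebesgue_measure_itv/= lte_fin.
have -> : fine (if a < t then (t%:E - a%:E)%E else 0%E) = t - a.
  by case: ltgtP at_ => // ->; rewrite subrr.
by rewrite le_eqVlt; apply/orP; left; apply/eqP; ring.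
Qed.

End Volterra.

(** * One step of the delay equation with Lebesgue measurable data *)

Section DelayStep.
Variable R : realType.
Notation mu := (@lebesgue_measure R).

Lemma locally_bounded_integrable (g : R -> R) (x y : R) :
  locally_bounded_measurable g -> mu.-integrable `[x, y] (EFin \o g).
Proof.
by move=> [mg gB]; have [B HB] := gB y; exact: (@bounded_integrable _ _ _ x y B).
Qed.

Lemma locally_bounded_locally_integrable (g : R -> R) :
  locally_bounded_measurable g -> locally_integrable [set: R] g.
Proof.
move=> lg; split; [by case: lg|exact: openT|move=> A _ cA].
have [B [_ HB]] := compact_bounded cA.
have AB : A `<=` `[- (B + 1), B + 1].
  by move=> x Ax; rewrite /= in_itv/= -ler_norml HB// ltrDl.
have mA : measurable A := compact_measurable cA.
have iA : mu.-integrable A (EFin \o g).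
  have := locally_bounded_integrable (- (B + 1)) (B + 1) lg.
  by apply: integrableS.
by have /integrableP[] := iA.
Qed.

Lemma ae_derive_primitive (a c : R) (g : R -> R) :
  locally_bounded_measurable g ->
  let u t := c + \int[mu]_(r in `[a, t]) g r in
  {ae mu, forall t, a < t -> derivable u t 1 /\ derive1 u t = g t}.
Proof.
move=> lg u.
have := @FTC1 R g (BLeft a) (fun y => locally_bounded_integrable a y lg)
  (locally_bounded_locally_integrable lg).
rewrite /=; apply: ae_imply => t Ft at_.
have [|dF F'] := Ft; first by rewrite lte_fin.
set F := (X in derivable X) in dF F'.
have -> : u = cst c \+ F by apply/funext => r.
split; first by apply: derivableD => //; exact: derivable_cst.
by rewrite derive1E deriveD// derive_cst add0r -derive1E.
Qed.

(** [volterra] takes Borel data on the whole line. The null set [N] collects the failures of Borel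
    measurability of [p] and [tau] and of the bound on [p]; altering the data there does not affect
    the equation almost everywhere. *)
Lemma delay_step (a b c K : R) (p tau h : R -> R) :
  lebesgue_measurable_fun `[a, b] p -> loc_ess_bounded `[a, b] p ->
  lebesgue_measurable_fun `[a, b] tau ->
  (forall t, a <= t <= b -> tau t <= t) ->
  measurable_fun setT h -> (forall t, `|h t| <= K) ->
  exists z, [/\ locally_bounded_measurable z,
    exists B, forall x y, x <= b -> y <= b -> `|z x - z y| <= B * `|x - y|,
    z a = c &
    {ae mu, forall t, a < t < b -> derivable z t 1 /\
      derive1 z t + p t * (if tau t < a then h (tau t) else z (tau t)) = 0}].
Proof.
move=> mp /(_ _ (@segment_compact _ a b) (@subset_refl _ _))[M pM] mtau taule mh hK.
have mab : measurable `[a, b]%classic := measurable_itv _.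
have [N1 [mN1 N10 mp1]] := lebesgue_borel_measurable mab mp.
have [N2 [mN2 N20 mtau2]] := lebesgue_borel_measurable mab mtau.
have [N3 [mN3 N30 pN3]] := pM.
pose N := N1 `|` (N2 `|` N3).
have mN : measurable N by apply: measurableU => //; exact: measurableU.
have N0 : mu.-negligible N.
  apply: negligibleU; first exact/negligibleP.
  by apply: negligibleU; exact/negligibleP.
pose D := `[a, b]%classic `\` N.
have mD : measurable D by exact: measurableD.
pose q := (fun t => - p t) \_ D.
(* [s] is the identity off [D], which keeps [s t <= t] everywhere; extending [tau] by 0 would break
   this at negative times. *)
pose s t := ((fun t => tau t - t) \_ D) t + t.
have mq : measurable_fun setT q.
  apply: (measurable_restrictT _ mD).1.
  apply: (@measurableT_comp _ _ _ _ _ _ (-%R : R -> R)) => //.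
  apply: measurable_funS mp1; first exact: measurableD.
  by apply: setDS; exact: subsetUl.
have ms : measurable_fun setT s.
  apply: measurable_funD => //; apply: (measurable_restrictT _ mD).1.
  apply: measurable_funB => //.
  apply: measurable_funS mtau2; first exact: measurableD.
  by apply: setDS => x Nx; right; left.
have qM t : `|q t| <= `|M| + 1.
  rewrite /q patchE; case: ifPn => [/set_mem[/= tab Nt]|_]; last first.
    by rewrite normr0 addr_ge0.
  rewrite normrN; have : `|p t| <= M.
    have [//|np] := pselect (`|p t| <= M); exfalso; apply: Nt; right; right.
    by apply: pN3 => /= /(_ tab).
  by move=> /le_trans; apply; rewrite (le_trans (ler_norm _))// lerDl.
have sle t : s t <= t.
  rewrite /s patchE; case: ifPn => [/set_mem[/= tab Nt]|_]; last by rewrite add0r.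
  by rewrite subrK taule//; move: tab; rewrite in_itv.
have M0 : 0 < `|M| + 1 by rewrite ltr_wpDl.
have [z [lz lg zE]] := volterra a c M0 mq ms mh qM sle hK.
exists z; split => //.
- have [mg gB] := lg; have [B HB] := gB b; exists B => x y xb yb.
  have := primitive_lipschitz a mg HB xb yb; rewrite !zE.
  by rewrite opprD addrACA subrr add0r.
- by rewrite zE set_itv1 Rintegral_set1 addr0.
- have := ae_derive_primitive a c lg.
  rewrite (_ : (fun t => _) = z); last by apply/funext.
  have : {ae mu, forall t, ~ N t}.
    by apply: negligibleS N0 => t /= /contrapT.
  apply: ae_imply2 => t Nt Hz /andP[at_ tb].
  have [dz z'E] := Hz at_; split => //; rewrite z'E.
  have Dt : t \in D by apply/mem_set; split => //=; rewrite in_itv/= !ltW.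
  by rewrite /q /s !patchE Dt subrK; ring.
Qed.

End DelayStep.

(** * Absolute continuity *)

Section AbsoluteContinuity.
Variable R : realType.
Implicit Types (D : set R) (f g : R -> R) (a b c t : R).

Lemma abs_contS D D' f : D' `<=` D -> abs_cont D f -> abs_cont D' f.
Proof.
move=> D'D fD e e0; have [d d0 H] := fD e e0; exists d => // n x y xy.
by apply: H => i; have [/D'D ? /D'D ?] := xy i.
Qed.

Lemma eq_abs_cont D f g : (forall t, D t -> f t = g t) ->
  abs_cont D f -> abs_cont D g.
Proof.
move=> fg fD e e0; have [d d0 H] := fD e e0; exists d => // n x y xy xyt xyd.
apply: le_lt_trans (H n x y xy xyt xyd); apply: ler_sum => i _.
by have [? ? _] := xy i; rewrite !fg.
Qed.

Lemma lipschitz_abs_cont D f B :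
  (forall x y, D x -> D y -> `|f x - f y| <= B * `|x - y|) -> abs_cont D f.
Proof.
move=> fB e e0; exists (e / (`|B| + 1)); first by rewrite divr_gt0// ltr_wpDl.
move=> n x y xy _; rewrite ltr_pdivlMr ?ltr_wpDl//; apply: le_lt_trans.
rewrite mulr_suml; apply: ler_sum => i _; have [Dx Dy xyi] := xy i.
apply: le_trans (fB _ _ Dy Dx) _; rewrite mulrC ger0_norm ?subr_ge0//.
rewrite ler_wpM2l ?subr_ge0//; apply: le_trans (ler_norm _) _.
by rewrite lerDl.
Qed.

Lemma abs_contD D f g : abs_cont D f -> abs_cont D g -> abs_cont D (f \+ g).
Proof.
move=> fD gD e e0; have e20 : 0 < e / 2 by rewrite divr_gt0.
have [d1 d10 H1] := fD _ e20; have [d2 d20 H2] := gD _ e20.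
exists (Num.min d1 d2); first by rewrite lt_min d10.
move=> n x y xy xyt; rewrite lt_min => /andP[xyd1 xyd2].
have := ltrD (H1 _ _ _ xy xyt xyd1) (H2 _ _ _ xy xyt xyd2).
rewrite -splitr; apply: le_lt_trans; rewrite -big_split/=; apply: ler_sum => i _.
by rewrite opprD addrACA ler_normD.
Qed.

Lemma abs_contZ D (k : R) f : abs_cont D f -> abs_cont D (fun t => k * f t).
Proof.
move=> fD e e0; have k0 : 0 < `|k| + 1 by rewrite ltr_wpDl.
have [d d0 H] := fD _ (divr_gt0 e0 k0); exists d => // n x y xy xyt xyd.
have := H n x y xy xyt xyd; rewrite ltr_pdivlMr// mulr_suml; apply: le_lt_trans.
apply: ler_sum => i _; rewrite -mulrBr normrM mulrC ler_wpM2l//.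
by rewrite lerDl.
Qed.

(* [m] truncates or translates the line, and [h] sends the points of
   ]m x, m y[ back into ]x, y[, which keeps disjoint intervals disjoint. *)
Lemma abs_cont_comp_sum D f (e d : R) (m h : R -> R) n (x y : 'I_n -> R) :
  (forall (n : nat) (a b : 'I_n -> R),
      (forall i, [/\ D (a i), D (b i) & a i <= b i]) ->
      trivIset setT (fun i => `]a i, b i[%classic) ->
      \sum_(i < n) (b i - a i) < d ->
      \sum_(i < n) `|f (b i) - f (a i)| < e) ->
  (forall x y, x <= y -> m x <= m y /\ m y - m x <= y - x) ->
  (forall x y z, m x < z < m y -> x < h z < y) ->
  (forall i, [/\ D (m (x i)), D (m (y i)) & x i <= y i]) ->
  trivIset setT (fun i => `]x i, y i[%classic) ->
  \sum_(i < n) (y i - x i) < d ->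
  \sum_(i < n) `|f (m (y i)) - f (m (x i))| < e.
Proof.
move=> H mono mh xy xyt xyd; apply: (H n (m \o x) (m \o y)).
- by move=> i; have [? ? /mono[]] := xy i.
- move=> i j _ _ [z [/=]]; rewrite !in_itv/= => zi zj.
  apply: xyt => //; exists (h z).
  by split; rewrite /= in_itv/=; [exact: mh zi|exact: mh zj].
- apply: le_lt_trans xyd; apply: ler_sum => i _.
  by have [_ _ /mono[]] := xy i.
Qed.

Lemma abs_cont_comp D D' f (m h : R -> R) :
  (forall t, D' t -> D (m t)) ->
  (forall x y, x <= y -> m x <= m y /\ m y - m x <= y - x) ->
  (forall x y z, m x < z < m y -> x < h z < y) ->
  abs_cont D f -> abs_cont D' (f \o m).
Proof.
move=> DD' mono mh fD e e0; have [d d0 H] := fD e e0; exists d => // n x y xy.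
apply: (abs_cont_comp_sum H mono mh) => i.
by have [/DD' ? /DD' ? ?] := xy i.
Qed.

Lemma abs_cont_shift D D' c f : (forall t, D' t -> D (t + c)) ->
  abs_cont D f -> abs_cont D' (fun t => f (t + c)).
Proof.
move=> DD'; apply: (@abs_cont_comp _ _ _ (fun t => t + c) (fun t => t - c)) => //.
- by move=> x y xy; rewrite lerD2r xy; split => //; rewrite opprD addrACA subrr addr0.
- by move=> x y z; rewrite ltrBrDr ltrBlDr.
Qed.

Lemma cvg_at_left_shift f c t (F : set_system R) :
  f @ (t + c)^'- --> F -> f (s + c) @[s --> t^'-] --> F.
Proof.
move=> ft; apply: cvg_comp ft => A [e e0 H]; exists e => // s se st.
apply: H; last by rewrite ltrD2r.
by move: se; rewrite /ball/= [t + c]addrC [s + c]addrC opprD addrACA subrr add0r.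
Qed.

Lemma cvg_at_right_shift f c t (F : set_system R) :
  f @ (t + c)^'+ --> F -> f (s + c) @[s --> t^'+] --> F.
Proof.
move=> ft; apply: cvg_comp ft => A [e e0 H]; exists e => // s se st.
apply: H; last by rewrite ltrD2r.
by move: se; rewrite /ball/= [t + c]addrC [s + c]addrC opprD addrACA subrr add0r.
Qed.

Lemma minr_monoB b x y : x <= y ->
  Num.min x b <= Num.min y b /\ Num.min y b - Num.min x b <= y - x.
Proof. by move=> xy; case: (leP x b) => ?; case: (leP y b) => ?; split; lra. Qed.

Lemma minr_between b x y z : Num.min x b < z < Num.min y b -> x < z < y.
Proof.
by case: (leP x b) => ?; case: (leP y b) => ? /andP[? ?]; apply/andP; split; lra.
Qed.

Lemma maxr_monoB b x y : x <= y ->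
  Num.max x b <= Num.max y b /\ Num.max y b - Num.max x b <= y - x.
Proof. by move=> xy; case: (leP x b) => ?; case: (leP y b) => ?; split; lra. Qed.

Lemma maxr_between b x y z : Num.max x b < z < Num.max y b -> x < z < y.
Proof.
by case: (leP x b) => ?; case: (leP y b) => ? /andP[? ?]; apply/andP; split; lra.
Qed.

(** On [[a, c]], f t = f (min t b) + f (max t b) - f b, and each truncation is a monotone
    contraction into one of the two pieces. *)
Lemma abs_cont_glue a b c f : a <= b -> b <= c ->
  abs_cont `[a, b] f -> abs_cont `[b, c] f -> abs_cont `[a, c] f.
Proof.
move=> ab bc fab fbc.
apply: (@eq_abs_cont _ ((f \o Num.min^~ b) \+ ((f \o Num.max^~ b) \+ cst (- f b)))).
  move=> t _ /=; rewrite minEle maxEle; case: ifP => _; first by rewrite subrr addr0.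
  by rewrite addrCA subrr addr0.
apply: abs_contD; last apply: abs_contD.
- apply: abs_cont_comp (@minr_monoB b) (@minr_between b) fab => t /=.
  by rewrite !in_itv/= le_min ge_min lexx orbT andbT ab => /andP[->].
- apply: abs_cont_comp (@maxr_monoB b) (@maxr_between b) fbc => t /=.
  by rewrite !in_itv/= ge_max le_max lexx orbT/= bc andbT => /andP[_ ->].
- by apply: (@lipschitz_abs_cont _ _ 0) => x y _ _; rewrite /= subrr normr0 mul0r.
Qed.

Lemma abs_cont_near D f t : abs_cont D f -> D t -> forall e, 0 < e ->
  exists2 d, 0 < d & forall s, D s -> `|s - t| < d -> `|f s - f t| < e.
Proof.
move=> fD Dt e e0; have [d d0 H] := fD e e0; exists d => // s Ds.
have {}H x y : D x -> D y -> x <= y -> y - x < d -> `|f y - f x| < e.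
  move=> Dx Dy xy xyd.
  have := H 1%N (fun=> x) (fun=> y); rewrite !big_ord1; apply => //.
  by move=> i j _ _ _; rewrite !ord1.
have [st|/ltW ts] := leP s t.
  by rewrite distrC [`|f _ - _|]distrC ger0_norm ?subr_ge0//; exact: H.
by rewrite ger0_norm ?subr_ge0//; exact: H.
Qed.

Lemma abs_cont_cvg_left D f a t : a < t -> (forall s, a <= s <= t -> D s) ->
  abs_cont D f -> f @ t^'- --> f t.
Proof.
move=> at_ atD fD; apply/cvgrPdist_lt => e e0.
have Dt : D t by apply: atD; rewrite lexx ltW.
have [d d0 H] := abs_cont_near fD Dt e0.
near=> s; rewrite distrC; apply: H.
  by apply: atD; apply/andP; split; near: s; [exact: nbhs_left_ge|exact: nbhs_left_le].
rewrite distrC ger0_norm; last by rewrite subr_ge0; near: s; exact: nbhs_left_le.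
rewrite ltrBlDr -ltrBlDl; near: s; apply: nbhs_left_gt; lra.
Unshelve. all: by end_near. Qed.

Lemma abs_cont_cvg_right D f b t : t < b -> (forall s, t <= s <= b -> D s) ->
  abs_cont D f -> f @ t^'+ --> f t.
Proof.
move=> tb tbD fD; apply/cvgrPdist_lt => e e0.
have Dt : D t by apply: tbD; rewrite lexx ltW.
have [d d0 H] := abs_cont_near fD Dt e0.
near=> s; rewrite distrC; apply: H.
  by apply: tbD; apply/andP; split; near: s; [exact: nbhs_right_ge|exact: nbhs_right_le].
rewrite ger0_norm; last by rewrite subr_ge0; near: s; exact: nbhs_right_ge.
rewrite ltrBlDl; near: s; apply: nbhs_right_lt; lra.
Unshelve. all: by end_near. Qed.

(** Intervals ending at [b] escape the hypothesis on [[a, b[]. All endpoints are truncated at c < b,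
    where the sum is below e / 2, and then c tends to [b]; the halving restores the strict
    inequality lost in the limit. *)
Lemma abs_cont_closure a b f : a < b ->
  abs_cont `[a, b[ f -> f @ b^'- --> f b -> abs_cont `[a, b] f.
Proof.
move=> ab fD fb e e0; have [d d0 H] := fD _ (divr_gt0 e0 (ltr0n R 2)).
exists d => // n x y xy xyt xyd.
have cv t : t \in `[a, b] -> f (Num.min t c) @[c --> b^'-] --> f t.
  rewrite in_itv/= => /andP[at_]; rewrite le_eqVlt => /predU1P[->|tb].
    apply: cvg_trans fb; apply: near_eq_cvg; near=> c.
    by rewrite (min_idPr _)//; near: c; exact: nbhs_left_le.
  apply: cvg_near_cst; near=> c.
  by rewrite (min_idPl _)//; near: c; exact: nbhs_left_ge.
have : \sum_(i < n) `|f (Num.min (y i) c) - f (Num.min (x i) c)| @[c --> b^'-]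
   --> \sum_(i < n) `|f (y i) - f (x i)|.
  apply: cvg_big => [|i _]; first exact: add_continuous.
  have [xi yi _] := xy i.
  by apply: cvg_norm; apply: cvgB; exact: cv.
move=> cvs; apply: (@le_lt_trans _ _ (e / 2)); last by lra.
rewrite -(cvg_lim (@Rhausdorff R) cvs); apply: limr_le; first exact/cvg_ex/ex_intro/cvs.
near=> c; apply: ltW.
apply: (abs_cont_comp_sum H (@minr_monoB c) (@minr_between c)) => // i.
have ac : a <= c by near: c; exact: nbhs_left_ge.
have cb : c < b by near: c; exact: nbhs_left_lt.
have [+ + xyi] := xy i; rewrite /= !in_itv/= => /andP[axi _] /andP[ayi _].
by rewrite !le_min axi ayi ac !gt_min cb !orbT.
Unshelve. all: by end_near. Qed.

End AbsoluteContinuity.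

(** * Existence for the impulsive equation *)

Section LocalEquality.
Variable R : realType.

Lemma derive_local_affine (f g : R -> R) (k c a b t : R) :
  a < t < b -> (forall s, a < s < b -> f s = k * g (s + c)) ->
  derivable g (t + c) 1 ->
  derivable f t 1 /\ derive1 f t = k * derive1 g (t + c).
Proof.
move=> atb fg dg.
have dgk : is_derive t 1 (fun s => k * g (s + c)) (k * derive1 g (t + c)).
  rewrite derive1E.
  have dgc : is_derive (t + c) 1 g ('D_1 g (t + c)) by exact: derivableP.
  have ds : is_derive t (1 : R) (fun s => s + c) 1.
    by apply: is_derive_eq; rewrite addr0.
  have := @is_derive1_comp _ g (fun s => s + c) t _ _ dgc ds.
  rewrite mulr1 => dc.
  exact: (@is_deriveZ _ _ _ (g \o (fun s => s + c)) k).
have fgt : \forall s \near t, k * g (s + c) = f s.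
  have : t \in `]a, b[ by rewrite in_itv.
  move=> /near_in_itvoo; apply: filterS => s; rewrite in_itv/= => /fg.
  exact: esym.
have [df f'] := near_eq_is_derive fgt dgk.
by rewrite derive1E.
Qed.

Lemma eq_at_left (f g : R -> R) (a b : R) : a < b ->
  (forall s, a < s < b -> f s = g s) -> f @ b^'- = g @ b^'-.
Proof.
move=> ab fg; rewrite eqEsubset; split; apply: near_eq_cvg; near=> s.
  by rewrite fg//; apply/andP; split; near: s; [exact: nbhs_left_gt|exact: nbhs_left_lt].
by rewrite fg//; apply/andP; split; near: s; [exact: nbhs_left_gt|exact: nbhs_left_lt].
Unshelve. all: by end_near. Qed.

Lemma eq_at_right (f g : R -> R) (a b : R) : a < b ->
  (forall s, a < s < b -> f s = g s) -> f @ a^'+ = g @ a^'+.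
Proof.
move=> ab fg; rewrite eqEsubset; split; apply: near_eq_cvg; near=> s.
  by rewrite fg//; apply/andP; split; near: s; [exact: nbhs_right_gt|exact: nbhs_right_lt].
by rewrite fg//; apply/andP; split; near: s; [exact: nbhs_right_gt|exact: nbhs_right_lt].
Unshelve. all: by end_near. Qed.

End LocalEquality.

Section Existence.
Variables (R : realType) (ell : nat) (theta : int -> R) (p tau : R -> R).
Variable lambda : nat -> R.
Notation mu := (@lebesgue_measure R).

Lemma theta_natS k : theta (k%:Z + 1) = theta k.+1%:Z.
Proof. by congr theta; lia. Qed.

Lemma theta_le (m : int) : (forall k : int, m <= k -> theta k < theta (k + 1)) ->
  forall j k : int, m <= j -> j <= k -> theta j <= theta k.
Proof.
move=> incr j k mj jk; have -> : k = j + `|k - j|%N%:Z by lia.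
elim: `|_|%N => [|n IH]; first by rewrite addr0.
apply: le_trans IH _; have -> : j + n.+1%:Z = (j + n%:Z) + 1 by lia.
by apply/ltW/incr; lia.
Qed.

Lemma theta_lt (m : int) : (forall k : int, m <= k -> theta k < theta (k + 1)) ->
  forall j k : int, m <= j -> j < k -> theta j < theta k.
Proof.
move=> incr j k mj jk; apply: lt_le_trans (incr _ mj) _.
by apply: (theta_le incr); lia.
Qed.

Hypothesis theta_incr : forall k : int, - ell.+1%:Z <= k -> theta k < theta (k + 1).
Hypothesis theta_infty : theta k%:Z @[k --> \oo] --> +oo.

Lemma theta_unbounded t : exists k : nat, t < theta k%:Z.
Proof.
have /cvgryPgt /(_ t) [N _ HN] := theta_infty.
by exists N; apply: HN => /=.
Qed.

Lemma theta_interval t : theta 0 <= t ->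
  exists k : nat, theta k%:Z <= t < theta k.+1%:Z.
Proof.
move=> t0; have [k] := theta_unbounded t; elim: k => [|k IH tk].
  by rewrite ltNge t0.
by have [/IH//|kt] := ltP t (theta k%:Z); exists k; rewrite kt.
Qed.

Hypothesis p_meas : lebesgue_measurable_fun `[theta 0, +oo[ p.
Hypothesis p_bnd : loc_ess_bounded `[theta 0, +oo[ p.
Hypothesis tau_meas : lebesgue_measurable_fun `[theta 0, +oo[ tau.
Hypothesis tau_le : forall t, theta 0 <= t -> tau t <= t.

Let T0 (k : nat) : theta 0 <= theta k%:Z.
Proof. by apply: (theta_le theta_incr); lia. Qed.

Let TS (k : nat) : theta k%:Z < theta k.+1%:Z.
Proof. by apply: (theta_lt theta_incr); lia. Qed.

Let bounded_meas (h : R -> R) := measurable_fun setT h /\ exists K, forall t, `|h t| <= K.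

(** The value imposed by the impulse at theta_k. It reads [h] only to the left of theta_(k - ell) <=
    theta_k, where the solution is already built. *)
Let start (h : R -> R) (k : nat) := lambda k * lim (h @ (theta (k%:Z - ell%:Z))^'-).

(** The boundedness premise sits inside the property, so that [choice] yields a step function
    defined on all pairs. *)
Let step_prop (kh : nat * (R -> R)) (z : R -> R) : Prop :=
  let a := theta kh.1%:Z in let b := theta kh.1.+1%:Z in
  bounded_meas kh.2 ->
  [/\ locally_bounded_measurable z,
    exists B, forall x y, x <= b -> y <= b -> `|z x - z y| <= B * `|x - y|,
    z a = start kh.2 kh.1 &
    {ae mu, forall t, a < t < b -> derivable z t 1 /\
      derive1 z t + p t * (if tau t < a then kh.2 (tau t) else z (tau t)) = 0}].

Let step_ex kh : exists z, step_prop kh z.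
Proof.
case: kh => k h; rewrite /step_prop /=.
have [[mh [K hK]]|nh] := pselect (bounded_meas h); last by exists h.
have sub : `[theta k%:Z, theta k.+1%:Z] `<=` `[theta 0, +oo[.
  by move=> t /=; rewrite !in_itv/= andbT => /andP[kt _]; exact: le_trans kt.
have mray : (completed_algebra_gen mu).-sigma.-measurable `[theta 0, +oo[%classic.
  apply: sub_sigma_algebra; exists `[theta 0, +oo[%classic; first exact: measurable_itv.
  by exists set0; [exact: negligible_set0|rewrite setU0].
have := @delay_step R (theta k%:Z) (theta k.+1%:Z) (start h k) K p tau h.
move=> [].
- exact: (measurable_funS mray sub).
- by move=> A cA AD; apply: p_bnd => //; exact: subset_trans sub.
- exact: (measurable_funS mray sub).
- by move=> t /andP[kt _]; apply: tau_le; exact: le_trans kt.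
- exact: mh.
- exact: hK.
by move=> z Hz; exists z.
Qed.

Lemma cvg_left_lipschitz (z : R -> R) (b : R) :
  (exists B, forall x y, x <= b -> y <= b -> `|z x - z y| <= B * `|x - y|) ->
  z @ b^'- --> z b.
Proof.
move=> [B zB]; apply: (@abs_cont_cvg_left _ [set t | t <= b] _ (b - 1)).
- by rewrite gtrBl.
- by move=> s /andP[].
- by apply: (@lipschitz_abs_cont _ _ _ B) => x y; exact: zB.
Qed.

(* Each new piece is frozen after its right end, which keeps the iterates bounded
   on the whole line. *)
Fixpoint method_of_steps (step : nat * (R -> R) -> R -> R) (h : R -> R) (k : nat)
    : R -> R :=
  if k is k'.+1 then
    let x := method_of_steps step h k' in
    fun t => if t < theta k'%:Z then x t
             else step (k', x) (Num.min t (theta k'.+1%:Z))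
  else h.

Lemma solution_I_exists (phi : R -> R) : rho tau (theta 0) < theta (- ell%:Z) ->
  initial_function theta tau phi ->
  exists x, solution_I_init ell theta p tau lambda phi x.
Proof.
move=> rho_lt phiD; have [step stepP] := choice step_ex.
rewrite /initial_function in phiD; set r := rho tau (theta 0) in rho_lt phiD.
have ell0 : theta (- ell%:Z) <= theta 0 by apply: (theta_le theta_incr); lia.
have r0 : r < theta 0 by exact: lt_le_trans ell0.
(* Extending [phi] by its end values makes it absolutely continuous on the line, hence Borel, and
   bounded, as [delay_step] asks of the past. *)
pose clamp t := Num.max (Num.min t (theta 0)) r.
have clampE t : r <= t <= theta 0 -> clamp t = t.
  by move=> /andP[rt t0]; rewrite /clamp (min_idPl t0) (max_idPl rt).
have clamp_in t : r <= clamp t <= theta 0.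
  by rewrite /clamp le_max lexx orbT ge_max ge_min lexx orbT ltW.
pose phi' := phi \o clamp.
have phi'D : abs_cont setT phi'.
  apply: (@abs_cont_comp _ [set t | t <= theta 0] setT (phi \o Num.max^~ r)
    (Num.min^~ (theta 0)) id _ (@minr_monoB _ _) (@minr_between _ _)).
    by move=> t _ /=; rewrite ge_min lexx orbT.
  apply: (@abs_cont_comp _ `[r, theta 0]%classic _ phi (Num.max^~ r) id _
    (@maxr_monoB _ _) (@maxr_between _ _)) phiD.
  by move=> t /= t0; rewrite in_itv/= le_max lexx orbT ge_max t0 ltW.
have phi'_cont : continuous phi'.
  move=> t; apply/cvgrPdist_lt => e e0.
  have [d d0 H] := abs_cont_near phi'D (I : [set: R] t) e0.
  have := nbhsx_ballx t d d0; apply: filterS => s; rewrite /ball/= => ts.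
  by rewrite distrC; apply: H => //; rewrite distrC.
pose X := method_of_steps step phi'.
have XS k t : X k.+1 t = if t < theta k%:Z then X k t
    else step (k, X k) (Num.min t (theta k.+1%:Z)) by [].
have XP k : bounded_meas (X k).
  elim: k => [|k [mX [K XK]]].
    split; first exact: continuous_measurable_fun.
    have := @continuous_compact _ _ phi' _ (continuous_subspaceT phi'_cont)
      (@segment_compact _ r (theta 0)).
    move=> /compact_bounded[B [_ HB]]; exists (B + 1) => t.
    apply: HB; first by rewrite ltrDl.
    by exists (clamp t); rewrite /= ?in_itv//= /phi' /= clampE.
  have [[mz zb] _ _ _] := stepP (k, X k) (conj mX (ex_intro _ K XK)).
  split.
    apply: measurable_fun_ifT => //; first exact: measurable_fun_ltr.
    apply: measurableT_comp => //; exact: measurable_minr.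
  have [B HB] := zb (theta k.+1%:Z); exists (Num.max K B) => t.
  rewrite XS; have [_|_] := ltP t (theta k%:Z).
    by apply: le_trans (XK t) _; rewrite le_max lexx.
  apply: le_trans (HB _ _) _; first by rewrite ge_min lexx orbT.
  by rewrite le_max lexx orbT.
pose z k := step (k, X k).
have Xstable k m t : t < theta k%:Z -> (k <= m)%N -> X m t = X k t.
  move=> tk km; rewrite -(subnKC km); elim: (m - k)%N => [|n IH]; first by rewrite addn0.
  rewrite addnS XS IH ifT//; apply: lt_le_trans tk _.
  by apply: (theta_le theta_incr); lia.
have [K KP] := choice theta_unbounded.
(* Any index whose theta lies beyond t gives the same value, by [Xstable]. *)
pose x t := X (K t) t.
have xE k t : t < theta k%:Z -> x t = X k t.
  move=> tk; rewrite /x; have [kK|/ltnW Kk] := leqP k (K t).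
    exact: Xstable.
  by rewrite (Xstable (K t) k).
have xz k t : theta k%:Z <= t < theta k.+1%:Z -> x t = z k t.
  move=> /andP[kt tk]; rewrite (xE k.+1)// XS ltNge kt/= /z.
  by rewrite (min_idPl (ltW tk)).
have x0 t : t < theta 0 -> x t = phi' t by move=> /(xE 0%N).
have zP k := stepP (k, X k) (XP k).
have cvz k : z k @ (theta k.+1%:Z)^'- --> z k (theta k.+1%:Z).
  by apply: cvg_left_lipschitz; have [_ zl _ _] := zP k.
have zD k : abs_cont `[theta k%:Z, theta k.+1%:Z] (z k).
  have [_ [B HB] _ _] := zP k; apply: (@lipschitz_abs_cont _ _ _ B) => u v.
  by rewrite /= !in_itv/= => /andP[_ uk] /andP[_ vk]; exact: HB.
have xk k : x (theta k%:Z) = z k (theta k%:Z) by apply: xz; rewrite lexx TS.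
exists x; split.
- move=> k; rewrite theta_natS; split.
  + apply: (@eq_abs_cont _ _ (z k)).
      by move=> t /=; rewrite in_itv/= => /xz.
    by apply: abs_contS (zD k); exact: subset_itv_co_cc.
  + case: k => [|k].
      (* The left limit at theta_0 is that of the initial function, whatever the impulse at theta_0
         does. *)
      rewrite (@eq_at_left _ x phi' r)//; last by move=> s /andP[_ /x0].
      apply/cvg_ex; exists (phi' (theta 0)).
      by apply: cvg_at_left_filter; exact: phi'_cont.
    rewrite (@eq_at_left _ x (z k) _ _ (TS k)).
      by apply/cvg_ex; eexists; exact: cvz.
    by move=> s /andP[/ltW ks sk]; apply: xz; rewrite ks.
  + rewrite (@eq_at_right _ x (z k) _ _ (TS k)); last first.
      by move=> s /andP[/ltW ks sk]; apply: xz; rewrite ks.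
    rewrite xk; apply: abs_cont_cvg_right (TS k) _ (zD k) => s.
    by rewrite /= in_itv.
- move=> t /andP[rt t0]; rewrite x0// /phi' /= clampE// rt ltW//.
- have zae k : {ae mu, forall t, theta k%:Z < t < theta k.+1%:Z ->
      derivable (z k) t 1 /\ derive1 (z k) t + p t * x (tau t) = 0}.
    have [_ _ _] := zP k; apply: ae_imply => t H ktk; have [dz Hz] := H ktk.
    split => //; rewrite -[RHS]Hz; congr (_ + _ * _).
    have /andP[kt tk] := ktk.
    have taut := tau_le (le_trans (T0 k) (ltW kt)).
    (* The delayed time falls either before theta_k, where x is [X k], or in the current interval,
       where x is [z k]. *)
    have [/xE//|ktau] := ltP (tau t) (theta k%:Z); apply: xz; rewrite ktau.
    exact: le_lt_trans tk.
  have := ae_foralln zae; apply: ae_imply => t H t0 tne.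
  have [k /andP[kt tk]] := theta_interval t0.
  have ktk : theta k%:Z < t < theta k.+1%:Z.
    by rewrite tk andbT lt_neqAle kt andbT; apply/eqP => /esym; exact: tne.
  have [dz Hz] := H k ktk.
  have := @derive_local_affine _ x (z k) 1 0 _ _ t ktk.
  rewrite addr0 mul1r => /(_ _ dz)[|dx ->] //.
  by move=> s /andP[/ltW ks sk]; rewrite mul1r addr0; apply: xz; rewrite ks.
- move=> k; have [_ _ /= zk _] := zP k; rewrite xk /z zk /start.
  (* For k = 0 this left neighbour is theta_(-(ell + 1)), the smallest index at which monotonicity
     is known. *)
  congr (_ * _); congr (lim _); apply: (@eq_at_left _ _ _ (theta (k%:Z - ell%:Z - 1))).
    by apply: (theta_lt theta_incr); lia.
  move=> s /andP[_ sk]; rewrite (xE k)//; apply: lt_le_trans sk _.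
  by apply: (theta_le theta_incr); lia.
Qed.

End Existence.

(** * The time change *)

Section TimeChange.
Variables (R : realType) (ell : nat) (theta : int -> R) (i : nat).
Hypothesis i_le : (i <= ell)%N.
Hypothesis theta_incr : forall k : int, - ell.+1%:Z <= k -> theta k < theta (k + 1).

(* Blocks are numbered from 0 here: [a n, b n[ and V n are the paper's block of
   index n - 1 and vtheta_(n - 1). *)
Let a n := theta (idx ell i (n%:Z - 1)).
Let b n := theta (idx ell i (n%:Z - 1) + 1).
Let V n := vtheta ell theta i (n%:Z - 1).

Lemma idx_ge n : - ell.+1%:Z <= idx ell i (n%:Z - 1).
Proof. by rewrite /idx; nia. Qed.

Lemma idxS n : idx ell i (n.+1%:Z - 1) = (n * ell.+1 + i)%N%:Z.
Proof. by rewrite /idx; lia. Qed.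

Lemma idx_pred n : idx ell i (n%:Z - 1) = (n * ell.+1 + i)%N%:Z - ell.+1%:Z.
Proof. by rewrite /idx; lia. Qed.

Lemma block_lt n : a n < b n.
Proof. exact/theta_incr/idx_ge. Qed.

Lemma block_le_next n m : (n < m)%N -> b n <= a m.
Proof.
move=> nm; apply: (theta_le theta_incr); first by have := idx_ge n; lia.
by rewrite !idx_pred; nia.
Qed.

Lemma block_le n m : (n <= m)%N -> a n <= a m.
Proof.
rewrite leq_eqVlt => /predU1P[->//|/block_le_next]; apply: le_trans.
exact/ltW/block_lt.
Qed.

Lemma block_uniq n m t : a n <= t < b n -> a m <= t < b m -> n = m.
Proof.
move=> /andP[ant tbn] /andP[amt tbm]; have [/block_le_next bam|/block_le_next ban|//] := ltngtP n m.
  by have := lt_le_trans tbn (le_trans bam amt); rewrite ltxx.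
by have := lt_le_trans tbm (le_trans ban ant); rewrite ltxx.
Qed.

Lemma vthetaS n : V n.+1 = vtheta_nat ell theta i n.
Proof. by rewrite /V (_ : n.+1%:Z - 1 = n%:Z); last lia. Qed.

Lemma vtheta1 : V 1 = theta 0. Proof. exact: vthetaS. Qed.

Lemma vtheta_step n : V n.+1 = V n + (b n - a n).
Proof.
case: n => [|n].
  by rewrite vtheta1 /V (_ : 0%:Z - 1 = -1)//= /b /a (_ : 0%:Z - 1 = -1)//= subrK.
rewrite !vthetaS /= /a /b (_ : n.+1%:Z - 1 = n%:Z); last by lia.
by rewrite addrA.
Qed.

Lemma vtheta_ltS n : V n < V n.+1.
Proof. by rewrite vtheta_step ltrDl subr_gt0 block_lt. Qed.

Lemma vtheta_le n m : (n <= m)%N -> V n <= V m.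
Proof.
move=> nm; rewrite -(subnKC nm); elim: (m - n)%N => [|k IH]; first by rewrite addn0.
by rewrite addnS; exact: le_trans IH (ltW (vtheta_ltS _)).
Qed.

Lemma vtheta_lt n m : (n < m)%N -> V n < V m.
Proof. by move=> /vtheta_le; exact: lt_le_trans (vtheta_ltS _). Qed.

(** Turns the conditions in the index sets of [alpha] and [coef_N] into inequalities between block
    numbers. *)
Lemma vtheta_le_iff n m s : V n <= s < V n.+1 -> (V m <= s) = (m <= n)%N.
Proof.
move=> /andP[Vns sVn]; have [/vtheta_le/le_trans->//|nm] := leqP m n.
by apply/negbTE; rewrite -ltNge; exact: lt_le_trans sVn (vtheta_le nm).
Qed.

Lemma vtheta_uniq n m s : V n <= s < V n.+1 -> V m <= s < V m.+1 -> n = m.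
Proof.
move=> Hn Hm; apply/eqP; rewrite eqn_leq -(vtheta_le_iff _ Hn) -(vtheta_le_iff _ Hm).
by case/andP: Hn => -> _; case/andP: Hm => ->.
Qed.

(** Each gap a_(j+1) - b_j is the increment of a_j - V_j, because V_(j+1) - V_j = b_j - a_j; hence
    the sum in [alpha] telescopes. *)
Lemma alphaE n s : V n <= s < V n.+1 -> alpha ell theta i s = s + (a n - V n).
Proof.
move=> Vs; rewrite /alpha -vtheta1 (vtheta_le_iff _ Vs).
case: n Vs => [|n] Vs /=.
  by have := vtheta_step 0; rewrite /a /b /V /= => ->; ring.
(* Since vtheta_j is [V j.+1], the gaps passed by a point of block n.+1 are those with 1 <= j <=
   n. *)
have -> : [set j : nat | (0 < j)%N /\ V 1 < vtheta ell theta i j%:Z <= s] =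
    [set` index_iota 1 n.+1].
  apply/seteqP; split => j /=; rewrite mem_index_iota.
    move=> [j0 /andP[_]].
    by rewrite -vthetaS (vtheta_le_iff _ Vs) ltnS j0 => ->.
  move=> /andP[j0 jn]; split => //.
  by rewrite -vthetaS (vtheta_le_iff _ Vs) jn andbT vtheta_lt.
rewrite -fsbig_seq; last exact: iota_uniq.
have -> : theta i%:Z = a 1 by rewrite /a; congr theta; rewrite /idx; lia.
suff -> : \sum_(1 <= j < n.+1)
    (theta (idx ell i j%:Z) - theta (idx ell i (j%:Z - 1) + 1)) =
    a n.+1 - V n.+1 - (a 1 - V 1) by ring.
elim: n {Vs} => [|n IH]; first by rewrite big_geq// subrr.
rewrite big_nat_recr//= IH (vtheta_step n.+1).
have -> : theta (idx ell i n.+1%:Z) = a n.+2.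
  by rewrite /a; congr theta; rewrite /idx; lia.
by rewrite -/(b n.+1); ring.
Qed.

Variable lambda : nat -> R.
Hypothesis lambda_pos : forall k : nat, 0 < lambda k.
Let Lam n := \prod_(j < n) lambda (j * ell.+1 + i).

Lemma Lam_gt0 n : 0 < Lam n.
Proof. by apply: prodr_gt0. Qed.

Lemma LamS n : Lam n.+1 = Lam n * lambda (n * ell.+1 + i).
Proof. by rewrite /Lam big_ord_recr. Qed.

Lemma coef_NE p sigma n m s : V n <= s < V n.+1 -> V m <= sigma s < V m.+1 ->
  (m <= n)%N ->
  coef_N ell theta p lambda i sigma s = Lam m / Lam n * p (alpha ell theta i s).
Proof.
move=> Vs Vm mn; rewrite /coef_N; congr (_ * _).
(* Again vtheta_j is [V j.+1], so the condition means m <= j < n. *)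
have -> : [set j : nat | sigma s < vtheta ell theta i j%:Z <= s] =
    [set` index_iota m n].
  apply/seteqP; split => j /=; rewrite mem_index_iota -vthetaS;
    by rewrite (vtheta_le_iff _ Vs) ltNge (vtheta_le_iff _ Vm) -leqNgt.
rewrite -fsbig_seq; last exact: iota_uniq.
rewrite -(subnKC mn); elim: (n - m)%N => [|k IH].
  by rewrite addn0 big_geq// divff// gt_eqF// Lam_gt0.
rewrite addnS big_nat_recr/= ?leq_addr// IH LamS.
have := gt_eqF (Lam_gt0 (m + k)); have := gt_eqF (lambda_pos ((m + k) * ell.+1 + i)).
by move=> /negbT h1 /negbT h2; field; rewrite h1.
Qed.

Variables (p tau sigma : R -> R).
Hypothesis theta_infty : theta k%:Z @[k --> \oo] --> +oo.
Hypothesis tau_le : forall t, theta 0 <= t -> tau t <= t.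
Hypothesis cover : \bigcup_(nu in [set: nat])
    `[vtheta ell theta i (nu%:Z - 1), vtheta ell theta i nu%:Z[%classic
  = `[vtheta ell theta i (-1), +oo[%classic.
Hypothesis sigma_codom : forall t, theta 0 <= t -> vtheta ell theta i (-1) <= sigma t.
Hypothesis sigma_alpha : forall t, theta 0 <= t ->
  alpha ell theta i (sigma t) = tau (alpha ell theta i t).

Lemma vtheta_block s : V 0 <= s -> exists n, V n <= s < V n.+1.
Proof.
move=> V0s; have : `[vtheta ell theta i (-1), +oo[%classic s.
  by rewrite /= in_itv/= andbT.
by rewrite -cover => -[n _ /=]; rewrite in_itv/= -vthetaS; exists n.
Qed.

Lemma block_ge0 n : (0 < n)%N -> theta 0 <= a n.
Proof.
move=> n0; apply: (theta_le theta_incr); first by lia.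
by case: n n0 => // n _; rewrite idxS; lia.
Qed.

Lemma block_of_vtheta n s : V n <= s < V n.+1 -> a n <= s + (a n - V n) < b n.
Proof. by rewrite vtheta_step; lra. Qed.

Lemma vtheta_of_block n t : a n <= t < b n -> V n <= t + (V n - a n) < V n.+1.
Proof. by rewrite vtheta_step; lra. Qed.

(** If m > n, then tau at alpha s, which equals alpha at sigma s, would lie in a later block than
    alpha s, against tau t <= t. *)
Lemma sigma_block n s : theta 0 <= s -> V n <= s < V n.+1 ->
  exists m, [/\ (m <= n)%N, V m <= sigma s < V m.+1 &
    tau (s + (a n - V n)) = sigma s + (a m - V m)].
Proof.
move=> s0 Vs; have [m Vm] := vtheta_block (sigma_codom s0); exists m.
have E := sigma_alpha s0; rewrite (alphaE Vs) (alphaE Vm) in E.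
split=> //; rewrite leqNgt; apply/negP => nm.
have n0 : (0 < n)%N by rewrite -(vtheta_le_iff _ Vs) vtheta1.
have /andP[ant tbn] := block_of_vtheta Vs; have /andP[amt _] := block_of_vtheta Vm.
have := tau_le (le_trans (block_ge0 n0) ant); rewrite -E; apply/negP; rewrite -ltNge.
by apply: lt_le_trans tbn _; apply: le_trans amt; exact: block_le_next.
Qed.

Definition linked (x y : R -> R) : Prop :=
  forall n s, V n <= s < V n.+1 -> x (s + (a n - V n)) = Lam n * y s.

(** Multiplying the equation for y by Lam n turns the coefficient Lam m / Lam n into the factor Lam
    m of x at the delayed time. The block is open because a two-sided derivative needs the
    translation on a neighbourhood. *)
Lemma linked_ode x y n s : linked x y -> (0 < n)%N -> V n < s < V n.+1 ->
  let t := s + (a n - V n) in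
  derivable y s 1 /\ derive1 y s + coef_N ell theta p lambda i sigma s * y (sigma s) = 0
  <-> derivable x t 1 /\ derive1 x t + p t * x (tau t) = 0.
Proof.
move=> xy n0 Vs t; have Vs' : V n <= s < V n.+1 by lra.
have s0 : theta 0 <= s by rewrite -vtheta1 (vtheta_le_iff _ Vs').
have [m [mn Vm tauE]] := sigma_block s0 Vs'.
have -> : x (tau t) = Lam m * y (sigma s) by rewrite tauE xy.
rewrite (coef_NE _ Vs' Vm mn) (alphaE Vs') -/t.
have Ln := Lam_gt0 n; have Ln0 : Lam n != 0 by rewrite gt_eqF.
have tb : a n < t < b n by rewrite /t; move: Vs; rewrite vtheta_step; lra.
have ts : t + (V n - a n) = s by rewrite /t; ring.
split => -[d E].
  have [dx ->] : derivable x t 1 /\ derive1 x t = Lam n * derive1 y (t + (V n - a n)).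
    apply: (derive_local_affine tb); last by rewrite ts.
    move=> u ub; rewrite -xy; first by congr x; ring.
    by apply: vtheta_of_block; lra.
  split=> //; rewrite ts -[RHS](mulr0 (Lam n)) -E; field; exact: Ln0.
have [dy ->] : derivable y s 1 /\ derive1 y s = (Lam n)^-1 * derive1 x (s + (a n - V n)).
  apply: (derive_local_affine Vs) => // u ub; rewrite xy ?mulKf//; lra.
split=> //; rewrite -/t -[RHS](mulr0 (Lam n)^-1) -E; field; exact: Ln0.
Qed.

Lemma S_block t : S_ ell theta i t -> exists2 n, (0 < n)%N & a n <= t < b n.
Proof.
move=> [n _]; rewrite /block /= in_itv/= => nt; exists n.+1 => //.
by rewrite /a /b (_ : n.+1%:Z - 1 = n%:Z); last lia.
Qed.

Lemma block_S n t : (0 < n)%N -> a n <= t < b n -> S_ ell theta i t.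
Proof.
case: n => // n _; rewrite /a /b (_ : n.+1%:Z - 1 = n%:Z); last by lia.
by exists n => //; rewrite /block /= in_itv.
Qed.

(** [Q] stands for either sign condition. Thresholds are carried over as starts of blocks: the time
    change is no global translation, but it preserves the order of blocks. *)
Lemma linked_eventually (Q : R -> Prop) x y : linked x y ->
  (forall k z, 0 < k -> Q (k * z) <-> Q z) ->
  (exists T, forall t, S_ ell theta i t -> T <= t -> Q (x t)) <->
  (exists T, forall t, `[vtheta ell theta i (-1), +oo[%classic t -> T <= t -> Q (y t)).
Proof.
move=> xy Qk; split => -[T HT].
  have [k Tk] := theta_unbounded theta_infty T.
  have Ta : T <= a k.+1.
    apply: le_trans (ltW Tk) _; apply: (theta_le theta_incr); first by lia.
    by rewrite idxS; nia.
  exists (V k.+1) => s _ Vks.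
  have [n Vn] := vtheta_block (le_trans (vtheta_le (leq0n _)) Vks).
  have kn : (k.+1 <= n)%N by rewrite -(vtheta_le_iff _ Vn).
  have n0 : (0 < n)%N by exact: leq_ltn_trans kn.
  apply/(Qk (Lam n)); first exact: Lam_gt0.
  have bn := block_of_vtheta Vn.
  rewrite -xy//; apply: HT; first exact: block_S bn.
  by apply: le_trans Ta (le_trans (block_le kn) _); case/andP: bn.
have [|k /andP[_ Tk]] := @vtheta_block (Num.max T (V 0)).
  by rewrite le_max lexx orbT.
exists (a k.+1) => t /S_block[n n0 nt] akt.
have kn : (k < n)%N.
  rewrite ltnNge; apply/negP => nk; case/andP: nt => _; apply/negP; rewrite -leNgt.
  by apply: le_trans akt; exact: block_le_next.
have Vn := vtheta_of_block nt.
have -> : t = t + (V n - a n) + (a n - V n) by ring.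
rewrite (xy _ _ Vn); apply/Qk; first exact: Lam_gt0.
have nu := le_trans (vtheta_le kn) (proj1 (andP Vn)).
apply: HT; first by rewrite /= in_itv/= andbT (le_trans (vtheta_le (leq0n k.+1))).
by apply: le_trans nu; move: Tk; rewrite gt_max => /andP[/ltW].
Qed.

Lemma linked_oscillatory x y : linked x y ->
  oscillatory_on (S_ ell theta i) x <->
  oscillatory_on `[vtheta ell theta i (-1), +oo[ y.
Proof.
move=> xy; rewrite /oscillatory_on.
have Hp : eventually_pos (S_ ell theta i) x <->
    eventually_pos `[vtheta ell theta i (-1), +oo[ y.
  by apply: (@linked_eventually (fun z => 0 < z)) => // k z k0; rewrite pmulr_rgt0.
have Hn : eventually_neg (S_ ell theta i) x <->
    eventually_neg `[vtheta ell theta i (-1), +oo[ y.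
  by apply: (@linked_eventually (fun z => z < 0)) => // k z k0; rewrite pmulr_rlt0.
by rewrite Hp Hn.
Qed.

(** * Transfer of solutions between (I) and (N_i) *)

Hypothesis theta_last : theta (- ell.+1%:Z) = rho tau (theta 0).

(** On block 0 both problems read the initial function. *)
Lemma block0_sub t : t < b 0 -> a 0 <= t -> rho tau (theta 0) <= t < theta 0.
Proof.
move=> tb at_; rewrite -theta_last; apply/andP; split.
  by apply: le_trans at_; apply: (theta_le theta_incr) => //; exact: idx_ge.
by apply: lt_le_trans tb _; apply: (theta_le theta_incr); rewrite /idx; lia.
Qed.

Lemma block_nat n : a n.+1 = theta (n * ell.+1 + i)%N%:Z.
Proof. by rewrite /a idxS. Qed.

Lemma block_nat_end n : b n.+1 = theta ((n * ell.+1 + i)%N%:Z + 1).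
Proof. by rewrite /b idxS. Qed.

(** The impulse at the start of block n.+1 thus reads the left limit at the end of block n: a jump
    delay of [ell] steps couples only intervals whose indices are congruent modulo ell + 1. *)
Lemma block_jump n : theta ((n * ell.+1 + i)%N%:Z - ell%:Z) = b n.
Proof. by rewrite /b idx_pred; congr theta; lia. Qed.

Lemma solution_N_of_I phi x : initial_function theta tau phi ->
  solution_I_init ell theta p tau lambda phi x ->
  exists2 y, linked x y & solution_N_init ell theta p lambda i sigma phi y.
Proof.
move=> phiD [xk x0 xode xjump].
have ex s : exists n, V 0 <= s -> V n <= s < V n.+1.
  by have [/vtheta_block[n]|] := boolP (V 0 <= s); [exists n|exists 0%N].
have [N NP] := choice ex.
pose y s := (Lam (N s))^-1 * x (s + (a (N s) - V (N s))).
have yE n s : V n <= s < V n.+1 -> y s = (Lam n)^-1 * x (s + (a n - V n)).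
  move=> Vs; rewrite /y.
  have V0s : V 0 <= s by apply: le_trans (vtheta_le (leq0n n)) _; case/andP: Vs.
  by rewrite (vtheta_uniq (NP s V0s) Vs).
have xy : linked x y.
  by move=> n s Vs; rewrite (yE n)// mulVKf// gt_eqF// Lam_gt0.
have xD n : abs_cont `[a n, b n[ x.
  case: n => [|n]; last by rewrite block_nat block_nat_end; have [] := xk (n * ell.+1 + i)%N.
  apply: (@eq_abs_cont _ _ phi).
    move=> t; rewrite /= in_itv/= => /andP[at_ tb]; apply/esym/x0; exact: block0_sub.
  apply: abs_contS phiD => t; rewrite /= !in_itv/= => /andP[at_ tb].
  by have /andP[-> /ltW ->] := block0_sub tb at_.
have xcvg n : cvg (x @ (b n)^'-).
  case: n => [|n]; last first.
    rewrite block_nat_end theta_natS.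
    by have [] := xk (n * ell.+1 + i).+1%N.
  rewrite (@eq_at_left _ x phi (a 0)); last 2 first.
  - exact: block_lt.
  - by move=> s /andP[/ltW as_ sb]; apply: x0; exact: block0_sub.
  apply/cvg_ex; exists (phi (b 0)).
  apply: (@abs_cont_cvg_left _ _ _ (a 0) _ _ _ phiD); first exact: block_lt.
  move=> s /andP[as_ sb]; rewrite /= in_itv/= -theta_last.
  apply/andP; split.
    by apply: le_trans as_; apply: (theta_le theta_incr) => //; exact: idx_ge.
  apply: le_trans sb _; apply: (theta_le theta_incr); rewrite /idx; lia.
have yleft n : y @ (V n.+1)^'- --> y (V n.+1).
  have Vn1 : V n.+1 <= V n.+1 < V n.+2 by rewrite lexx vtheta_ltS.
  (* The new factor of Lam n.+1 cancels the lambda of the impulse, leaving (Lam n)^-1 times the left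
     limit of x at [b n]. *)
  rewrite (yE _ _ Vn1) addrCA subrr addr0 LamS block_nat xjump block_jump.
  rewrite invfM -mulrA mulKf; last by rewrite gt_eqF.
  rewrite (@eq_at_left _ y (fun s => (Lam n)^-1 * x (s + (a n - V n))) (V n)); last 2 first.
  - exact: vtheta_ltS.
  - by move=> s /andP[/ltW Vs sV]; apply: yE; rewrite Vs.
  apply: cvgM; first exact: cvg_cst.
  apply: cvg_at_left_shift.
  have -> : V n.+1 + (a n - V n) = b n by rewrite vtheta_step; ring.
  exact: xcvg.
have yD n : abs_cont `[V n, V n.+1] y.
  apply: abs_cont_closure; [exact: vtheta_ltS| |exact: yleft].
  apply: (@eq_abs_cont _ _ (fun s => (Lam n)^-1 * x (s + (a n - V n)))).
    by move=> s /=; rewrite in_itv/= => /yE.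
  apply: abs_contZ; apply: abs_cont_shift (xD n) => s /=.
  by rewrite !in_itv/=; exact: block_of_vtheta.
exists y => //; split.
- move=> c Vc; have [n /andP[_ /ltW cn]] := vtheta_block Vc.
  have : abs_cont `[V 0, V n.+1] y.
    elim: n {cn} => [|n IH]; first exact: yD.
    by apply: abs_cont_glue IH (yD _); [exact: vtheta_le|exact/ltW/vtheta_ltS].
  apply: abs_contS => s; rewrite /= !in_itv/= => /andP[-> sc].
  exact: le_trans cn.
(* The block of s is not fixed beforehand, so the equation for x is required at all countably many
   translates of s, and the breakpoints [V n] are discarded. *)
- have := ae_neq V; have : {ae @lebesgue_measure R, forall t, forall n : nat,
      (fun u => theta 0 <= u -> (forall k : nat, u <> theta k%:Z) ->
         derivable x u 1 /\ derive1 x u + p u * x (tau u) = 0) (t + (a n - V n))}.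
    by apply: ae_foralln => n; exact: (ae_addr (a n - V n) xode).
  apply: ae_imply2 => s xs sV s0.
  have [n Vs] : exists n, V n <= s < V n.+1.
    by apply: vtheta_block; apply: le_trans s0; rewrite -vtheta1 vtheta_le.
  have n0 : (0 < n)%N by rewrite -(vtheta_le_iff _ Vs) vtheta1.
  have Vs' : V n < s < V n.+1.
    by move: Vs => /andP[Vs ->]; rewrite andbT lt_neqAle Vs andbT; apply/eqP/nesym.
  apply/(linked_ode xy n0 Vs'); apply: xs.
    by apply: le_trans (block_ge0 n0) _; have /andP[] := block_of_vtheta Vs.
  have tb : a n < s + (a n - V n) < b n by move: Vs'; rewrite vtheta_step; lra.
  case: n n0 tb {Vs Vs'} => // n _; rewrite block_nat block_nat_end => /andP[kt tk] k E.
  move: kt tk; rewrite E => kt tk.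
  (* The translated point lies strictly between two consecutive theta, so it is no impulse time. *)
  have [km|mk] := leqP k (n * ell.+1 + i).
    move: kt; rewrite ltNge => /negP; apply; apply: (theta_le theta_incr); lia.
  move: tk; rewrite ltNge => /negP; apply; apply: (theta_le theta_incr); lia.
- move=> s; rewrite -vtheta1 => Vs; rewrite (yE 0%N) ?Vs// (alphaE (n := 0) Vs).
  rewrite /Lam big_ord0 invr1 mul1r; apply: x0.
  by have /andP[at_ tb] := block_of_vtheta (n := 0) Vs; exact: block0_sub.
Qed.

Hypothesis S_tau : forall t, theta 0 <= t ->
  (S_ ell theta i t <-> hatS ell theta i (tau t)).

Lemma hatS_block t : hatS ell theta i t <-> exists n, a n <= t < b n.
Proof.
split => [[n _]|[n nt]]; first by rewrite /block /= in_itv/=; exists n.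
by exists n => //; rewrite /block /= in_itv.
Qed.

Lemma interval_uniq (j k : int) t : - ell.+1%:Z <= j -> - ell.+1%:Z <= k ->
  theta j <= t < theta (j + 1) -> theta k <= t < theta (k + 1) -> j = k.
Proof.
move=> j0 k0 /andP[jt tj] /andP[kt tk].
have [jk|kj|//] := ltgtP j k.
  have : theta (j + 1) <= theta k by apply: (theta_le theta_incr); lia.
  by move=> /(lt_le_trans tj); rewrite ltNge kt.
have : theta (k + 1) <= theta j by apply: (theta_le theta_incr); lia.
by move=> /(lt_le_trans tk); rewrite ltNge jt.
Qed.

Lemma solution_I_of_N phi y x : solution_N_init ell theta p lambda i sigma phi y ->
  solution_I_init ell theta p tau lambda phi x ->
  exists2 x', linked x' y & solution_I_init ell theta p tau lambda phi x'.
Proof.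
move=> [yD yode y0] [xk x0 xode xjump].
have ex t : exists n, S_ ell theta i t -> a n <= t < b n.
  have [/S_block[n _ nt]|] := pselect (S_ ell theta i t); first by exists n.
  by exists 0%N.
have [M MP] := choice ex.
pose x' t := if pselect (S_ ell theta i t) then
  Lam (M t) * y (t + (V (M t) - a (M t))) else x t.
have x'S n t : (0 < n)%N -> a n <= t < b n -> x' t = Lam n * y (t + (V n - a n)).
  move=> n0 nt; rewrite /x'; have St := block_S n0 nt.
  by case: pselect => // St'; rewrite (block_uniq (MP t St) nt).
have x'N t : ~ S_ ell theta i t -> x' t = x t by rewrite /x'; case: pselect.
have x'0 t : t < theta 0 -> x' t = x t.
  move=> t0; apply: x'N => /S_block[n /block_ge0 an /andP[nt _]].
  by have := lt_le_trans t0 (le_trans an nt); rewrite ltxx.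
(* The formula persists on block 0, which lies before theta_0: there x is [phi], y is [phi] composed
   with alpha, and Lam 0 = 1. *)
have x'b n t : a n <= t < b n -> x' t = Lam n * y (t + (V n - a n)).
  case: n => [|n] nt; last exact: x'S.
  have Vt := vtheta_of_block nt; have /andP[at_ tb] := nt.
  have /andP[rt t0] := block0_sub tb at_.
  rewrite x'0// x0 ?rt// /Lam big_ord0 mul1r y0 ?(alphaE (n := 0) Vt) -?vtheta1//.
  by congr phi; ring.
have xy : linked x' y.
  move=> n s Vs; rewrite (x'b n); last exact: block_of_vtheta.
  by congr (_ * y _); ring.
(* These are the indices of the intervals that make up hatS_i. *)
pose good (j : int) := exists n, j = idx ell i (n%:Z - 1).
have x'bad (j : int) t : - ell.+1%:Z <= j -> ~ good j ->
    theta j <= t < theta (j + 1) -> x' t = x t.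
  move=> j0 jbad jt; apply: x'N => /S_block[n _ nt]; apply: jbad; exists n.
  by apply: interval_uniq jt nt => //; exact: idx_ge.
have yleft n : y @ (V n.+1)^'- --> y (V n.+1).
  have V0n := vtheta_le (leq0n n.+1).
  apply: (@abs_cont_cvg_left _ _ _ (V 0) _ _ _ (yD _ V0n)).
    exact: vtheta_lt.
  by move=> s; rewrite /= in_itv.
have x'left n : x' @ (b n)^'- --> Lam n * y (V n.+1).
  rewrite (@eq_at_left _ x' (fun t => Lam n * y (t + (V n - a n))) (a n)); last 2 first.
  - exact: block_lt.
  - by move=> s /andP[/ltW as_ sb]; apply: x'b; rewrite as_.
  apply: cvgM; first exact: cvg_cst.
  apply: cvg_at_left_shift.
  have -> : b n + (V n - a n) = V n.+1 by rewrite vtheta_step; ring.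
  exact: yleft.
have x'val n : x' (a n) = Lam n * y (V n).
  by rewrite (x'b n) ?lexx ?block_lt//; congr (_ * y _); ring.
have kge (k : nat) : - ell.+1%:Z <= k%:Z by lia.
exists x' => //; split.
- move=> k; split.
  + have [[n kn]|kbad] := pselect (good k%:Z); last first.
      apply: (@eq_abs_cont _ _ x); last by have [] := xk k.
      by move=> t /=; rewrite in_itv/= => /(x'bad _ _ (kge k) kbad).
    rewrite kn -/(a n) -/(b n).
    apply: (@eq_abs_cont _ _ (fun t => Lam n * y (t + (V n - a n)))).
      by move=> t /=; rewrite in_itv/= => /x'b.
    apply: abs_contZ; apply: abs_cont_shift (yD (V n.+1) (vtheta_le (leq0n _))) => t /=.
    rewrite !in_itv/= => /vtheta_of_block/andP[Vt /ltW ->]; rewrite andbT.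
    exact: le_trans (vtheta_le (leq0n n)) Vt.
  + case: k => [|k].
      rewrite (@eq_at_left _ x' x (theta 0 - 1)); last 2 first.
      - by rewrite gtrBl.
      - by move=> s /andP[_ /x'0].
      by have [] := xk 0%N.
    (* A left limit at theta_(k + 1) depends on the interval with index k, so the case split is on k
       and not on k + 1. *)
    have [[n kn]|kbad] := pselect (good k%:Z).
      rewrite -theta_natS kn; apply/cvg_ex; eexists; exact: x'left.
    rewrite (@eq_at_left _ x' x (theta k%:Z)); last 2 first.
    - by rewrite -theta_natS; exact: theta_incr.
    - move=> s /andP[/ltW ks sk]; apply: (x'bad _ _ (kge k) kbad).
      by rewrite theta_natS ks.
    by have [] := xk k.+1.
  + have [[n kn]|kbad] := pselect (good k%:Z); last first.
      rewrite (@eq_at_right _ x' x _ (theta (k%:Z + 1))); last 2 first.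
      - exact: theta_incr.
      - by move=> s /andP[/ltW ks sk]; apply: (x'bad _ _ (kge k) kbad); rewrite ks.
      rewrite (x'bad _ _ (kge k) kbad) ?lexx ?theta_incr//.
      by have [] := xk k.
    rewrite kn -/(a n) x'val.
    rewrite (@eq_at_right _ x' (fun t => Lam n * y (t + (V n - a n))) _ (b n)); last 2 first.
    - exact: block_lt.
    - by move=> s /andP[/ltW as_ sb]; apply: x'b; rewrite as_.
    apply: cvgM; first exact: cvg_cst.
    apply: cvg_at_right_shift.
    have -> : a n + (V n - a n) = V n by ring.
    apply: (@abs_cont_cvg_right _ _ _ (V n.+1) _ _ _ (yD (V n.+1) (vtheta_le (leq0n _)))).
      exact: vtheta_ltS.
    move=> s /andP[ns sn]; rewrite /= in_itv/= sn andbT.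
    exact: le_trans (vtheta_le (leq0n n)) ns.
- by move=> t /andP[rt t0]; rewrite x'0// x0// rt.
- have yode' : {ae @lebesgue_measure R, forall t, forall n : nat,
      (fun u => theta 0 <= u -> derivable y u 1 /\
         derive1 y u + coef_N ell theta p lambda i sigma u * y (sigma u) = 0)
      (t + (V n - a n))}.
    by apply: ae_foralln => n; exact: (ae_addr (V n - a n) yode).
  have := yode'; apply: ae_imply2 xode => t xt yt t0 tne.
  have [k /andP[kt tk]] := theta_interval theta_infty t0.
  have ktk : theta k%:Z < t < theta (k%:Z + 1).
    by rewrite theta_natS tk andbT lt_neqAle kt andbT; apply/eqP/nesym/tne.
  have [[n kn]|kbad] := pselect (good k%:Z).
    have nt : a n < t < b n by rewrite /a /b -kn.
    have n0 : (0 < n)%N.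
      by case: n kn {nt} => // /eqP; rewrite idx_pred mul0n add0n => /eqP kn; lia.
    have Vs : V n < t + (V n - a n) < V n.+1 by rewrite vtheta_step; lra.
    have := (linked_ode xy n0 Vs).1.
    have -> : t + (V n - a n) + (a n - V n) = t by ring.
    apply; apply: yt; rewrite -vtheta1.
    by apply: le_trans (vtheta_le n0) _; case/andP: Vs => /ltW.
  have [dx E] := xt t0 tne.
  have tS : ~ S_ ell theta i t.
    move=> /S_block[n _ nt]; apply: kbad; exists n.
    apply: (@interval_uniq _ _ t) nt => //; first exact: idx_ge.
    by case/andP: ktk => /ltW -> ->.
  (* If tau t were in S_i, which is part of hatS_i, then [S_tau] would put t in S_i. *)
  have tauS : x' (tau t) = x (tau t).
    apply: x'N => /S_block[n _ nt]; apply: tS.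
    by apply/(S_tau t0)/hatS_block; exists n.
  have := @derive_local_affine _ x' x 1 0 _ _ t ktk.
  rewrite addr0 mul1r tauS => /(_ _ dx)[|dx' ->] //.
  move=> s /andP[/ltW ks sk]; rewrite mul1r addr0; apply: (x'bad _ _ (kge k) kbad).
  by rewrite ks.
- move=> k; have [[n kn]|kbad] := pselect (good k%:Z).
    (* Block 0 has the negative index i - (ell + 1), so it starts at no impulse time theta_k with k
       >= 0. *)
    case: n kn => [|n kn]; first by rewrite idx_pred; lia.
    have kE : k = (n * ell.+1 + i)%N by move: kn; rewrite idxS; lia.
    rewrite kE -block_nat block_jump x'val (cvg_lim (@Rhausdorff R) (x'left n)).
    by rewrite LamS; ring.
  rewrite (x'bad _ _ (kge k) kbad) ?lexx ?theta_incr// xjump; congr (_ * _).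
  (* The left limit in the impulse lives on the interval with index k - (ell + 1), of the same
     residue as k and therefore also outside hatS_i. *)
  have kl : - ell.+1%:Z <= k%:Z - ell.+1%:Z by lia.
  have klbad : ~ good (k%:Z - ell.+1%:Z).
    move=> [n kn]; apply: kbad; exists n.+1; rewrite idxS.
    by move: kn; rewrite idx_pred; lia.
  have E : k%:Z - ell%:Z = k%:Z - ell.+1%:Z + 1 by lia.
  congr (lim _); apply/esym; apply: (@eq_at_left _ _ _ (theta (k%:Z - ell.+1%:Z))).
    by rewrite E; exact: theta_incr.
  by move=> s /andP[/ltW ks sk]; apply: (x'bad _ _ kl klbad); rewrite ks -E.
Qed.

End TimeChange.

Theorem theorem2 (R : realType) (ell : nat) (theta : int -> R)
    (p tau : R -> R) (lambda : nat -> R) (sigma : 'I_ell.+1 -> R -> R)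
    (p_meas : lebesgue_measurable_fun `[theta 0, +oo[ p)
    (p_bnd : loc_ess_bounded `[theta 0, +oo[ p)
    (tau_meas : lebesgue_measurable_fun `[theta 0, +oo[ tau)
    (tau_le : forall t, theta 0 <= t -> tau t <= t)
    (tau_infty : tau t @[t --> +oo] --> +oo)
    (theta_incr : forall k : int, - ell%:Z <= k -> theta k < theta (k + 1))
    (theta_infty : theta k%:Z @[k --> \oo] --> +oo)
    (theta_last : theta (- ell.+1%:Z) = rho tau (theta 0))
    (theta_last_lt : theta (- ell.+1%:Z) < theta (- ell%:Z))
    (lambda_pos : forall k : nat, 0 < lambda k)
    (vtheta_cover : forall i : 'I_ell.+1,
      \bigcup_(nu in [set: nat])
        `[vtheta ell theta i (nu%:Z - 1), vtheta ell theta i nu%:Z[%classic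
      = `[vtheta ell theta i (-1), +oo[%classic)
    (S_tau : forall (i : 'I_ell.+1) t, theta 0 <= t ->
      (S_ ell theta i t <-> hatS ell theta i (tau t)))
    (sigma_codom : forall (i : 'I_ell.+1) t, theta 0 <= t ->
      vtheta ell theta i (-1) <= sigma i t)
    (sigma_alpha : forall (i : 'I_ell.+1) t, theta 0 <= t ->
      alpha ell theta i (sigma i t) = tau (alpha ell theta i t))
    (sigma_beta : forall (i : 'I_ell.+1) t, theta 0 <= t ->
      hatS ell theta i t ->
      sigma i (beta ell theta i t) = beta ell theta i (tau t)) :
  forall i : 'I_ell.+1,
    (forall x : R -> R, solution_I ell theta p tau lambda x ->
       oscillatory_on (S_ ell theta i) x)
    <->
    (forall y : R -> R, solution_N ell theta p tau lambda i (sigma i) y ->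
       oscillatory_on `[vtheta ell theta i (-1), +oo[ y).
Proof.
move=> i; have i_le : (i <= ell)%N by rewrite -ltnS.
(* The gap from theta_(-(ell + 1)) to theta_(-ell) comes from [theta_last_lt], all later ones from
   [theta_incr]. *)
have incr (k : int) : - ell.+1%:Z <= k -> theta k < theta (k + 1).
  move=> k0; have [->|k1] := eqVneq k (- ell.+1%:Z); last by apply: theta_incr; lia.
  by rewrite (_ : - ell.+1%:Z + 1 = - ell%:Z) //; lia.
split=> [Hx y [phi phiD yN]|Hy x [phi phiD xI]].
  have rho_lt : rho tau (theta 0) < theta (- ell%:Z) by rewrite -theta_last.
  have [x xI] := solution_I_exists lambda incr theta_infty p_meas p_bnd tau_meas
    tau_le rho_lt phiD.
  have [x' x'y x'I] := solution_I_of_N i_le incr lambda_pos theta_infty tau_le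
    (vtheta_cover i) (sigma_codom i) (sigma_alpha i) theta_last (S_tau i) yN xI.
  have x'osc : oscillatory_on (S_ ell theta i) x' by apply: Hx; exists phi.
  exact: (linked_oscillatory i_le incr lambda_pos theta_infty (vtheta_cover i) x'y).1.
have [y xy yN] := solution_N_of_I i_le incr lambda_pos tau_le
  (vtheta_cover i) (sigma_codom i) (sigma_alpha i) theta_last phiD xI.
have yosc : oscillatory_on `[vtheta ell theta i (-1), +oo[ y.
  by apply: Hy; exists phi.
exact: (linked_oscillatory i_le incr lambda_pos theta_infty (vtheta_cover i) xy).2.
Qed.
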